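(* Let $(S_n)_{n\ge 0}$ be the minimal random walk with parameters $p,q,s\in[0,1]$, $(p,q)\neq(1,0)$, and let $a=p-q$. Assume $a>1/2$ (superdiffusive regime), let $\sigma^2=\frac{q(1-p)}{(1-a)^2}$, and let $L$ be the almost sure limit $$L=\lim_{n\to\infty}n^{1-a}\Big(\frac{S_n}{n}-\frac{q}{1-a}\Big).$$ Then, as $n\to\infty$, $$\sqrt{n^{2a-1}}\left(n^{1-a}\Big(\frac{S_n}{n}-\frac{q}{1-a}\Big)-L\right)\longrightarrow N\Big(0,\frac{\sigma^2}{2a-1}\Big)\quad\text{in distribution.}$$
   Context: Minimal random walk (MRW) with parameters $p,q,s\in[0,1]$: $S_0=0$, $S_1=X_1$ where $X_1$ has the Bernoulli distribution with success probability $s$. For every $n\ge1$, $$X_{n+1}=\alpha_{n+1}X_{U_n}+\beta_{n+1}(1-X_{U_n}),\qquad S_{n+1}=S_n+X_{n+1},$$ where $\alpha_{n+1}\sim$ Bernoulli$(p)$, $\beta_{n+1}\sim$ Bernoulli$(q)$, $U_n$ is uniform on $\{1,\dots,n\}$, and $\alpha_{n+1},\beta_{n+1},U_n$ are mutually independent and independent of $(X_1,\dots,X_n)$. Standing assumption: $a=p-q<1$, i.e. $(p,q)\ne(1,0)$. In the superdiffusive regime $a>1/2$ the limit $L$ is known to exist almost surely and in $L^2$. $N(0,0)$ denotes the Dirac mass at $0$. *)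

(* Defs.v *)
From HB Require Import structures.
From mathcomp Require Import all_boot all_order all_algebra.
From mathcomp Require Import all_classical all_reals all_analysis.
From mathcomp Require Import measurable_realfun.
Set Implicit Arguments.
Unset Strict Implicit.
Unset Printing Implicit Defensive.
Import Order.TTheory GRing.Theory Num.Theory numFieldNormedType.Exports.
Local Open Scope classical_set_scope.
Local Open Scope ring_scope.

(* [U] need only take its values in {1, ..., n} almost surely: the n point
   masses add up to 1. *)
Definition uniform_upto d (T : measurableType d) (R : realType)
    (P : probability T R) (n : nat) (U : {RV P >-> nat}) : Prop :=
  forall k, (1 <= k <= n)%N -> distribution P U [set k] = (n%:R^-1)%:E.

(* [alpha], [beta], [U] and the vector (X 1, ..., X n) are mutually independent.
   The product rule for subfamilies is the case where some of the sets are
   full.  All sets involved are measurable, the value types being discrete. *)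
Definition step_independent d (T : measurableType d) (R : realType)
    (P : probability T R) (alpha beta : {RV P >-> bool}) (U : {RV P >-> nat})
    (n : nat) (X : nat -> {RV P >-> bool}) : Prop :=
  forall (A B : set bool) (C : set nat) (D : set (n.-tuple bool)),
    let past := [set w | D [tuple X i.+1 w | i < n]] in
    P (alpha @^-1` A `&` beta @^-1` B `&` U @^-1` C `&` past) =
      (P (alpha @^-1` A) * P (beta @^-1` B) * P (U @^-1` C) * P past)%E.

(* [X n], [alpha n], [beta n] are the n-th variables for n >= 1 (n >= 2 for
   [alpha] and [beta]), [U n] is used for n >= 1; the other values of these
   sequences, in particular [X 0], play no role. *)
Record minimal_random_walk d (T : measurableType d) (R : realType)
    (P : probability T R) (p q s : R) (X alpha beta : nat -> {RV P >-> bool})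
    (U : nat -> {RV P >-> nat}) : Prop := MinimalRandomWalk {
  mrw_X1 : distribution P (X 1%N) =1 bernoulli_prob s ;
  mrw_alpha : forall n, (1 <= n)%N ->
    distribution P (alpha n.+1) =1 bernoulli_prob p ;
  mrw_beta : forall n, (1 <= n)%N ->
    distribution P (beta n.+1) =1 bernoulli_prob q ;
  mrw_U : forall n, (1 <= n)%N -> uniform_upto n (U n) ;
  mrw_indep : forall n, (1 <= n)%N ->
    step_independent (alpha n.+1) (beta n.+1) (U n) n X ;
  mrw_rec : forall n, (1 <= n)%N -> forall w,
    (X n.+1 w)%:R = (alpha n.+1 w)%:R * (X (U n w) w)%:R
                    + (beta n.+1 w)%:R * (1 - (X (U n w) w)%:R) :> R }.

Section position.
Context d (T : measurableType d) (R : realType) (P : probability T R).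
Variables (X : nat -> {RV P >-> bool}) (p q : R) (n : nat).

Definition position : T -> R := fun w => \sum_(1 <= k < n.+1) (X k w)%:R.

Lemma measurable_position : measurable_fun [set: T] position.
Proof.
apply: measurable_sum => k.
exact: (measurableT_comp (f := fun b : bool => b%:R : R)).
Qed.

HB.instance Definition _ :=
  isMeasurableFun.Build _ _ _ _ position measurable_position.

(* The value at n = 0, where 0 / 0 = 0 by convention, is irrelevant here. *)
Definition rescaled_position : T -> R := fun w =>
  let a := p - q in
  n%:R `^ (1 - a) * (position w / n%:R - q / (1 - a)).

Lemma measurable_rescaled_position : measurable_fun [set: T] rescaled_position.
Proof.
apply: measurable_funM => //; apply: measurable_funB => //.
by apply: measurable_funM => //; exact: measurable_position.
Qed.

HB.instance Definition _ := isMeasurableFun.Build _ _ _ _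
  rescaled_position measurable_rescaled_position.

End position.

(* Normal law with mean [m] and variance [v].  The library's [normal_prob m s]
   takes the standard deviation and is the uniform law on [0, 1] when s = 0. *)
Definition normal_law (R : realType) (m v : R) :
    probability (measurableTypeR R) R :=
  if v == 0 then \d_(m : measurableTypeR R) : probability _ _
  else normal_prob m (Num.sqrt v) : probability _ _.

Definition cvg_in_distribution d (T : measurableType d) (R : realType)
    (P : probability T R) (Z : nat -> {RV P >-> R})
    (mu : probability (measurableTypeR R) R) : Prop :=
  let F (x : R) := mu `]-oo, x]%classic in
  forall x, {for x, continuous F} -> cdf (Z n) x @[n --> \oo] --> F x.

(* Main.v *)
Require Import Defs.
From HB Require Import structures.
From mathcomp Require Import all_boot all_order all_algebra.
From mathcomp Require Import all_classical all_reals all_analysis.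
From mathcomp Require Import measurable_realfun.
From mathcomp Require Import ring lra.
Set Implicit Arguments.
Unset Strict Implicit.
Unset Printing Implicit Defensive.
Import Order.TTheory GRing.Theory Num.Theory numFieldNormedType.Exports.
Local Open Scope classical_set_scope.
Local Open Scope ring_scope.

(* Write c = q / (1 - a), D_m = S_m - m c and Y_m = D_m / m^a, so that Y_m -> L.
   Given the past, X_(m+1) is a Bernoulli variable of parameter c + a D_m / m,
   hence
     Y_(m+1) - Y_m = (X_(m+1) - E[X_(m+1) | past]) / (m+1)^a + k_m Y_m
   with 0 <= k_m <= 1 / m^2.  Multiplying by - n^(a - 1/2) and summing over
   m >= n, the fluctuation n^(a - 1/2) (Y_n - L) is a martingale tail plus a
   drift that vanishes in L^1.  Since E D_m^2 = O(m^(2a)), the conditional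
   variances tend to c (1 - c) = sigma^2 in L^1, and a second-order expansion of
   the cosine, one step at a time, gives
     E cos(t M + u) -> exp(- t^2 sigma^2 / (2 (2a - 1))) cos u
   for the martingale tail M, because
     n^(2a-1) sum_(m >= n) (m+1)^(-2a) -> 1 / (2a - 1).
   Taking all phases u replaces complex characteristic functions.  The passage
   to distribution functions uses the tightness given by the second moments: on
   [-K, K] an indicator is squeezed between ramps in sin (pi y / (2 K)), which
   are uniform limits of polynomials in that sine, hence of trigonometric
   polynomials. *)

(** * Elementary inequalities *)

(** The martingale tail is an infinite sum, so every estimate is made at a finite horizon N, with L
    replaced by Y_N and bounds that are uniform in N; for a bounded continuous function of the
    fluctuation, dominated convergence then lets N tend to infinity. At a finite horizon the history
    takes finitely many values and its law is a recursion on lists of bits: the conditional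
    expectation is the explicit average [chain_step], so that neither filtrations nor martingale
    theory enter. [Rintegral_history] carries the results over to the probability space. The
    constant c is the fixed point of x -> q + a x, and c (1 - c) = sigma^2 because 1 - a - q = 1 -
    p. One step of the chain multiplies the expected cosine by exp(- t^2 sigma^2 w^2 / 2), w being
    the weight of the step, up to an error whose expectation is proportional to w^2. This factor is
    deterministic and at most 1, so the errors add up without amplification, and the sum of the w^2
    is at most 1 / (2a - 1). *)

Section RealInequalities.
Context {R : realType}.
Implicit Types x y r t h : R.

(** Bernoulli's inequality for exponents in [0, 1], from the concavity of [ln] between 1 + x and 1.
    The point x = -1 and a non-positive right-hand side are set apart, since logarithms cannot be
    compared there. *)
Lemma powR_le1Dx x r : 0 <= r <= 1 -> 0 <= 1 + x -> (1 + x) `^ r <= 1 + r * x.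
Proof.
move=> /andP[r0 r1]; rewrite le_eqVlt => /predU1P[x0|x0].
  have -> : x = -1 by lra.
  have [->|rn0] := eqVneq r 0; first by rewrite powRr0; lra.
  by rewrite subrr powR0//; lra.
have [x1|x1] := leP (r * x) (-1).
  have rx0 : 0 <= r * (1 + x) by rewrite mulr_ge0// ltW.
  have r1' : r = 1 by lra.
  by move: x1; rewrite r1' mul1r; lra.
rewrite -ler_ln ?posrE ?powR_gt0//; last by lra.
rewrite ln_powR.
have := @concave_ln R (Itv01 r0 r1) (1 + x) 1 x0 ltr01.
rewrite ln1 /= !convRE /= mulr0 addr0 mulr1.
by rewrite (_ : r * (1 + x) + unstable.onem r = 1 + r * x)// /unstable.onem; ring.
Qed.

(** The previous inequality at r x with exponent 1 / r, raised to the power r. *)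
Lemma powR_ge1Dx x r : 1 <= r -> 0 <= 1 + x -> 1 + r * x <= (1 + x) `^ r.
Proof.
move=> r1 x0; have r0 : 0 < r by lra.
have [rx|rx] := ltP (1 + r * x) 0; first by rewrite (le_trans (ltW rx))// powR_ge0.
have := @powR_le1Dx (r * x) r^-1 _ rx.
rewrite invr_ge0 ltW//= invf_le1// r1 mulrA mulVf ?gt_eqF// mul1r => /(_ isT) H.
have := @ge0_ler_powR R r (ltW r0) _ _ _ _ H.
rewrite !nnegrE powR_ge0 => /(_ isT x0).
by rewrite -powRrM mulVf ?gt_eqF// powRr1.
Qed.

Lemma powRN_ge1Bx x r : 0 <= r -> 0 < 1 + x -> 1 - r * x <= (1 + x) `^ (- r).
Proof.
move=> r0 x0; rewrite /powR gt_eqF//.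
rewrite (le_trans _ (expR_ge1Dx _))// mulNr lerD2l lerN2 ler_wpM2l//.
by apply: le_ln1Dx; lra.
Qed.

(** 1 + y <= e^y gives e^(-y) <= 1 / (1 + y) <= 1 - y + y^2. *)
Lemma expRN_le_quad y : 0 <= y -> `|expR (- y) - (1 - y)| <= y ^+ 2.
Proof.
move=> y0; rewrite ger0_norm ?subr_ge0 ?expR_ge1Dx//.
have h : 1 + y <= expR y := expR_ge1Dx y.
have e0 := expR_gt0 (- y).
have : expR (- y) * expR y = 1 by rewrite -expRD addNr expR0.
nra.
Qed.

Lemma norm_sin_le x : `|sin x| <= `|x|.
Proof.
wlog x0 : x / 0 < x => [H|].
  have [x0|x0|->] := ltgtP x 0; last by rewrite sin0 normr0.
  - by rewrite -normrN -sinN -[leRHS]normrN H// oppr_gt0.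
  - exact: H.
have [] := @MVT R sin cos 0 x x0.
  by apply: continuous_subspaceT => y; exact: continuous_sin.
move=> c _; rewrite sin0 !subr0 => ->.
by rewrite normrM ler_piMl// cos_max.
Qed.

Lemma sqr_le_of_norm_le x y : `|x| <= `|y| -> x ^+ 2 <= y ^+ 2.
Proof.
move=> h; rewrite -(real_normK (num_real x)) -(real_normK (num_real y)).
by rewrite lerXn2r ?nnegrE.
Qed.

Lemma cos_ge1Bquad x : 1 - x ^+ 2 / 2 <= cos x.
Proof.
have := @cos_mulr2n R (x / 2).
rewrite (_ : x / 2 *+ 2 = x); last by field.
rewrite cos2sin2 mulr2n => ->.
have := sqr_le_of_norm_le (norm_sin_le (x / 2)).
rewrite exprMn; lra.
Qed.

Lemma sin_quad x : `|sin x - x| <= `|x| ^+ 3.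
Proof.
wlog x0 : x / 0 < x => [H|].
  have [x0|x0|->] := ltgtP x 0; last by rewrite sin0 subr0 normr0 expr0n.
  - by rewrite -normrN opprD -sinN -(normrN x) H// oppr_gt0.
  - exact: H.
have [] := @MVT R (fun y => sin y - y) (fun y => cos y - 1) 0 x x0.
  by apply: continuous_subspaceT => y; apply: cvgB; [exact: continuous_sin|exact: cvg_id].
move=> c; rewrite in_itv/= => /andP[c0 cx].
rewrite sin0 !subr0 => ->.
rewrite normrM (gtr0_norm x0) exprSr ler_wpM2r// ?(ltW x0)//.
rewrite ler0_norm ?subr_le0 ?cos_le1//.
have := cos_ge1Bquad c.
have : c ^+ 2 <= x ^+ 2 by rewrite lerXn2r ?nnegrE// ltW.
have := sqr_ge0 c.
lra.
Qed.

(** With x = 2 y the error is -2 (sin y - y) (sin y + y). It is at most 4 y^4, which suffices for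
    |y| <= 2; for larger |y| the crude bound 8 y^2 does. *)
Lemma cos_cubic x : `|cos x - (1 - x ^+ 2 / 2)| <= `|x| ^+ 3.
Proof.
have := @cos_mulr2n R (x / 2).
rewrite (_ : x / 2 *+ 2 = x); last by field.
rewrite cos2sin2 mulr2n => ->.
have -> : x = 2 * (x / 2) by field.
rewrite (_ : 2 * (x / 2) / 2 = x / 2); last by field.
move: (x / 2) => y.
have h1 := sin_quad y; have h2 := norm_sin_le y.
have -> : 1 - sin y ^+ 2 + (1 - sin y ^+ 2) - 1 - (1 - (2 * y) ^+ 2 / 2) =
  - 2 * ((sin y - y) * (sin y + y)) by field.
rewrite !normrM normrN normr_nat.
have h3 : `|sin y + y| <= 2 * `|y| by rewrite (le_trans (ler_normD _ _))//; lra.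
have y0 := normr_ge0 y; have s1 := normr_ge0 (sin y + y).
have [y1|y1] := leP `|y| 2.
  have : `|sin y - y| * `|sin y + y| <= `|y| ^+ 3 * (2 * `|y|) by rewrite ler_pM.
  have : `|y| ^+ 3 * `|y| <= `|y| ^+ 3 * 2 by rewrite ler_wpM2l// exprn_ge0.
  rewrite exprMn; lra.
have h4 : `|sin y - y| <= 2 * `|y| by rewrite (le_trans (ler_normB _ _))//; lra.
have : `|sin y - y| * `|sin y + y| <= (2 * `|y|) * (2 * `|y|) by rewrite ler_pM.
have : `|y| ^+ 2 * 2 <= `|y| ^+ 2 * `|y|.
  by rewrite ler_wpM2l// ?exprn_ge0// ltW.
have : 0 <= `|y| ^+ 2 by rewrite exprn_ge0.
rewrite exprMn; lra.
Qed.

Lemma cos_taylor x h :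
  `|cos (x + h) - (cos x - h * sin x - h ^+ 2 / 2 * cos x)| <= 2 * `|h| ^+ 3.
Proof.
rewrite cosD.
have -> : cos x * cos h - sin x * sin h - (cos x - h * sin x - h ^+ 2 / 2 * cos x)
  = cos x * (cos h - (1 - h ^+ 2 / 2)) - sin x * (sin h - h) by field.
rewrite (le_trans (ler_normB _ _))// !normrM mulr_natl mulr2n lerD//.
- by rewrite (le_trans _ (cos_cubic h))// ler_piMl// cos_max.
- by rewrite (le_trans _ (sin_quad h))// ler_piMl// sin_max.
Qed.

Lemma cos_lipschitz x h : `|cos (x + h) - cos x| <= `|h|.
Proof.
have -> : x + h = (x + h / 2) + h / 2 by field.
have {2}-> : x = (x + h / 2) - h / 2 by field.
rewrite cosD cosB.
set u := x + _; rewrite (_ : _ - _ = - (2 * sin u * sin (h / 2))); last by ring.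
rewrite normrN !normrM normr_nat.
have := norm_sin_le (h / 2); rewrite [`|h / 2|]normrM => h1.
have := sin_max u; have := normr_ge0 (sin u); have := normr_ge0 (sin (h / 2)).
rewrite [`|2^-1|]gtr0_norm// in h1.
nra.
Qed.

Lemma powR_natS_ge m r : (0 < m)%N -> 1 <= r ->
  (1 + r / m%:R) * m%:R `^ r <= (m.+1)%:R `^ r :> R.
Proof.
move=> m0 r1; have m0' : 0 < m%:R :> R by rewrite ltr0n.
have -> : (m.+1)%:R = (1 + m%:R^-1) * m%:R :> R.
  by rewrite -natr1 mulrDl mul1r mulVf ?gt_eqF// addrC.
have m1 : 0 <= 1 + m%:R^-1 :> R by rewrite addr_ge0// invr_ge0 (ltW m0').
by rewrite powRM ?(ltW m0')// ler_wpM2r ?powR_ge0// powR_ge1Dx.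
Qed.

Lemma powR_natD k x y : (0 < k)%N -> k%:R `^ (x + y) = k%:R `^ x * k%:R `^ y :> R.
Proof. by move=> k0; rewrite powRD// pnatr_eq0 -lt0n k0 implybT. Qed.

(** A discrete derivative of x^(-e), with the reverse bound in the next lemma: for e = 2a - 1 the
    two trap sums of (m+1)^(-2a) between telescoping sums. *)
Lemma powRN_step_le k (e : R) : (0 < k)%N -> 0 <= e ->
  k%:R `^ (- e) - k.+1%:R `^ (- e) <= e * k%:R `^ (- (e + 1)) :> R.
Proof.
move=> k0 e0; have k0' : 0 < k%:R :> R by rewrite ltr0n.
have -> : k.+1%:R = k%:R * (1 + k%:R^-1) :> R by rewrite -natr1; field; lra.
have k1 : 0 < 1 + k%:R^-1 :> R by rewrite addr_gt0// invr_gt0.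
rewrite powRM ?(ltW k0') ?(ltW k1)// opprD powR_natD// (powR_inv1 (ltW k0')).
have := @ler_wpM2l R (k%:R `^ (- e)) (powR_ge0 _ _) _ _ (powRN_ge1Bx e0 k1).
lra.
Qed.

Lemma powRN_step_ge k (e : R) : (0 < k)%N -> 0 <= e ->
  e * k.+1%:R `^ (- (e + 1)) <= k%:R `^ (- e) - k.+1%:R `^ (- e) :> R.
Proof.
move=> k0 e0; have k0' : 0 < k%:R :> R by rewrite ltr0n.
have k1' : 0 < k.+1%:R :> R by rewrite ltr0n.
have -> : k%:R = k.+1%:R * (1 + - k.+1%:R^-1) :> R by rewrite -natr1; field; lra.
have k1 : 0 < 1 + - k.+1%:R^-1 :> R.
  by rewrite subr_gt0 invf_lt1// ltr1n.
rewrite powRM ?(ltW k1') ?(ltW k1)// opprD powR_natD// (powR_inv1 (ltW k1')).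
have := @ler_wpM2l R (k.+1%:R `^ (- e)) (powR_ge0 _ _) _ _ (powRN_ge1Bx e0 k1).
move: (k.+1%:R^-1) => z; move: (_ `^ _) (_ `^ _) => x y; lra.
Qed.

Lemma expRN_lipschitz x y : 0 <= x -> x <= y ->
  `|expR (- x) - expR (- y) : R| <= y - x.
Proof.
move=> x0 xy; rewrite ger0_norm; last by rewrite subr_ge0 ler_expR; lra.
have -> : - y = - x + - (y - x) by ring.
rewrite expRD; have := expR_ge1Dx (- (y - x)).
have : expR (- x) <= 1 :> R by rewrite expR_le1 oppr_le0.
have : 0 < expR (- x) :> R by exact: expR_gt0.
by move: (expR (- x)) (expR _) => u v; nra.
Qed.

End RealInequalities.

(** * Uniform polynomial approximation of the absolute value on [-1, 1] *)

Section AbsApprox.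
Context {R : realType}.
Implicit Types x y : R.

(* Newton iteration for the square root of X^2, which converges monotonically. *)
Fixpoint abs_poly n : {poly R} :=
  if n is m.+1 then abs_poly m + 2^-1 *: ('X ^+ 2 - abs_poly m ^+ 2) else 0.

(** Write y for |x| and u for the iterate. A step multiplies the error y - u by 1 - (y + u) / 2 <= 1
    - y / 2, and (1 + (k + 1) y / 2) (1 - y / 2) <= 1 + k y / 2. The resulting error is at most 2 /
    n, uniformly down to y = 0. *)
Lemma abs_polyP n x : `|x| <= 1 ->
  0 <= (abs_poly n).[x] <= `|x| /\
  (1 + n%:R / 2 * `|x|) * (`|x| - (abs_poly n).[x]) <= `|x|.
Proof.
move=> x1; elim: n => [|n [/andP[u0 ux] IH]].
  by rewrite /= horner0 lexx normr_ge0 !mul0r addr0 subr0 mul1r.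
rewrite /= !hornerE /= -[x ^+ 2](real_normK (num_real x)) -(@natr1 R n).
move: (`|x| : R) ((abs_poly n).[x]) (n%:R) (ler0n R n) x1 u0 ux IH => y u k k0 y1 u0 uy IH.
have y0 : 0 <= y by lra.
have e : y - (u + 2^-1 * (y ^+ 2 - u ^+ 2)) = (y - u) * (1 - (y + u) / 2) by field.
have yu : 0 <= (y - u) * (y + u) by rewrite mulr_ge0; lra.
have yu2 : 0 <= (y - u) * (1 - (y + u) / 2) by rewrite mulr_ge0; lra.
split; first by apply/andP; split; lra.
rewrite e; have : (y - u) * (1 - (y + u) / 2) <= (y - u) * (1 - y / 2).
  by rewrite ler_wpM2l; lra.
have h1 : 0 <= 1 + (k + 1) / 2 * y by nra.
move=> /(ler_wpM2l h1) /le_trans; apply.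
have h2 : (1 + (k + 1) / 2 * y) * (1 - y / 2) <= 1 + k / 2 * y by nra.
rewrite [leLHS]mulrCA [_ * (1 - _)]mulrC.
rewrite [_ * (1 + _)]mulrC.
apply: le_trans (ler_wpM2l _ h2) _; first by lra.
by rewrite mulrC.
Qed.

Lemma abs_poly_approx (e : R) : 0 < e -> exists p : {poly R}, forall x, `|x| <= 1 ->
  `| `|x| - p.[x] | <= e.
Proof.
move=> e0; exists (abs_poly (Num.bound (2 / e))) => x x1.
set n := Num.bound _; have ne : 2 / e < n%:R.
  by have := archi_boundP (divr_ge0 (ler0n R 2) (ltW e0)).
have [/andP[u0 ux]] := abs_polyP n x1.
rewrite (@ger0_norm _ (`|x| - _)) ?subr_ge0//.
move: (`|x| : R) ((abs_poly n).[x]) (normr_ge0 x) ux u0 x1 => y u y0 uy u0 y1 h.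
rewrite ltr_pdivrMr// in ne.
rewrite leNgt; apply/negP => eyu.
have y0' : 0 < y by lra.
have c0 : 0 <= 1 + n%:R / 2 * y by rewrite addr_ge0// mulr_ge0.
have h1 := ler_wpM2l c0 (ltW eyu).
have : y * 2 < y * (n%:R * e) by rewrite ltr_pM2l.
by move: (n%:R) h h1 => k; lra.
Qed.
End AbsApprox.

(** * Expectations of bounded functions *)

Section BoundedExpectation.
Context d (T : measurableType d) (R : realType).
Implicit Types (f g : T -> R) (x : R) (P : probability T R).

Definition bounded_mfun f :=
  measurable_fun [set: T] f /\ exists M, forall t, `|f t| <= M.

Lemma bounded_mfun_integrable P f : bounded_mfun f ->
  P.-integrable [set: T] (EFin \o f).
Proof.
move=> [mf [M fM]]; apply: measurable_bounded_integrable => //.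
  by rewrite (le_lt_trans (probability_le1 P measurableT))// ltry.
by exists M; split; [exact: num_real|move=> x Mx t _; rewrite /= (le_trans (fM t))// ltW].
Qed.

Lemma bounded_mfun_cst x : bounded_mfun (fun=> x).
Proof. by split => //; exists `|x|. Qed.

Lemma bounded_mfunD f g : bounded_mfun f -> bounded_mfun g ->
  bounded_mfun (fun t => f t + g t).
Proof.
move=> [mf [M fM]] [mg [N gN]]; split; first exact: measurable_funD.
by exists (M + N) => t; rewrite (le_trans (ler_normD _ _))// lerD.
Qed.

Lemma bounded_mfunM f g : bounded_mfun f -> bounded_mfun g ->
  bounded_mfun (fun t => f t * g t).
Proof.
move=> [mf [M fM]] [mg [N gN]]; split; first exact: measurable_funM.
by exists (M * N) => t; rewrite normrM ler_pM.
Qed.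

Lemma bounded_mfunZ x f : bounded_mfun f -> bounded_mfun (fun t => x * f t).
Proof. by apply: bounded_mfunM; exact: bounded_mfun_cst. Qed.

Lemma bounded_mfun_norm f : bounded_mfun f -> bounded_mfun (fun t => `|f t|).
Proof.
move=> [mf [M fM]]; split; first exact: measurableT_comp.
by exists M => t; rewrite normr_id.
Qed.

Lemma bounded_mfun_indic (A : set T) : measurable A -> bounded_mfun (\1_A : T -> R).
Proof.
move=> mA; split; first exact: measurable_indic.
by exists 1 => t; rewrite indicE; case: (_ \in _); rewrite ?normr1 ?normr0.
Qed.

Lemma Rintegral_probability_cst P x : \int[P]_t x = x.
Proof. by rewrite Rintegral_cst// [X in fine X](probability_setT P) mulr1. Qed.

Lemma Rintegral_probability_indic P (A : set T) : measurable A ->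
  \int[P]_t (\1_A t : R) = fine (P A).
Proof. by move=> mA; rewrite /Rintegral integral_indic// setIT. Qed.

Lemma le_bounded_Rintegral P f g : bounded_mfun f -> bounded_mfun g ->
  (forall t, f t <= g t) -> \int[P]_t f t <= \int[P]_t g t.
Proof.
by move=> fb gb fg; apply: le_Rintegral => //; exact: bounded_mfun_integrable.
Qed.

Lemma bounded_RintegralD P f g : bounded_mfun f -> bounded_mfun g ->
  \int[P]_t (f t + g t) = \int[P]_t f t + \int[P]_t g t.
Proof. by move=> fb gb; rewrite RintegralD//; exact: bounded_mfun_integrable. Qed.

Lemma bounded_RintegralZ P x f : bounded_mfun f ->
  \int[P]_t (x * f t) = x * \int[P]_t f t.
Proof. by move=> fb; rewrite RintegralZl//; exact: bounded_mfun_integrable. Qed.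

Lemma bounded_Rintegral_dist P f g x : bounded_mfun f -> bounded_mfun g ->
  (forall t, `|f t - g t| <= x) -> `|\int[P]_t f t - \int[P]_t g t| <= x.
Proof.
have H u v : bounded_mfun u -> bounded_mfun v -> (forall t, `|u t - v t| <= x) ->
    \int[P]_t u t <= \int[P]_t v t + x.
  move=> ub vb uv; have cb := bounded_mfun_cst x.
  rewrite -[X in _ + X](Rintegral_probability_cst P) -bounded_RintegralD//.
  apply: le_bounded_Rintegral => // [|t]; first exact: bounded_mfunD.
  by have := uv t; rewrite ler_distl => /andP[].
move=> fb gb fgx; rewrite ler_distl lerBlDr !H// => t.
by rewrite distrC.
Qed.

End BoundedExpectation.

(** * Test functions whose integrals converge, starting from the cosines *)

Section TrigonometricConvergence.
Context {R : realType}.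
Local Notation TR := (measurableTypeR R).
Variables (mu_ : nat -> probability TR R) (mu : probability TR R).

(** Boundedness is bundled with the convergence so that linearity of the integral applies without
    side conditions. *)
Definition cvg_test (h : TR -> R) := bounded_mfun h /\
  \int[mu_ n]_x h x @[n --> \oo] --> \int[mu]_x h x.

Hypothesis mu_cos : forall th ph : R,
  \int[mu_ n]_x cos (th * (x : R) + ph) @[n --> \oo] --> \int[mu]_x cos (th * (x : R) + ph).

Lemma bounded_mfun_cos (th ph : R) : bounded_mfun (fun x : TR => cos (th * (x : R) + ph)).
Proof.
split; last by exists 1 => t; exact: cos_max.
apply: (measurableT_comp (f := @cos R)).
  by apply: continuous_measurable_fun; exact: continuous_cos.
by apply: measurable_funD => //; exact: measurable_funM.
Qed.

Lemma cvg_test_cos (th ph : R) : cvg_test (fun x : TR => cos (th * (x : R) + ph)).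
Proof. by split; [exact: bounded_mfun_cos|exact: mu_cos]. Qed.

Lemma cvg_testD f g : cvg_test f -> cvg_test g -> cvg_test (fun x => f x + g x).
Proof.
move=> [fb cf] [gb cg]; split; first exact: bounded_mfunD.
rewrite bounded_RintegralD//; under eq_fun do rewrite bounded_RintegralD//.
exact: cvgD.
Qed.

Lemma cvg_testZ a f : cvg_test f -> cvg_test (fun x => a * f x).
Proof.
move=> [fb cf]; split; first exact: bounded_mfunZ.
rewrite bounded_RintegralZ//; under eq_fun do rewrite bounded_RintegralZ//.
by apply: cvgM => //; exact: cvg_cst.
Qed.

Lemma cvg_test_cst a : cvg_test (fun=> a).
Proof.
split; first exact: bounded_mfun_cst.
rewrite Rintegral_probability_cst.
under eq_fun do rewrite Rintegral_probability_cst.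
exact: cvg_cst.
Qed.

Lemma cvg_test_eq f g : f =1 g -> cvg_test f -> cvg_test g.
Proof. by move=> /funext ->. Qed.

(** Since 2 sin A cos B = sin (A + B) + sin (A - B), one factor sine is traded for new frequencies
    and phases; a sine is a cosine with phase shifted by - pi / 2. Hence the induction over all
    [th'] and [ph]. *)
Lemma cvg_test_sin_cos (th : R) k (th' ph : R) :
  cvg_test (fun x : TR => sin (th * (x : R)) ^+ k * cos (th' * (x : R) + ph)).
Proof.
elim: k th' ph => [|k IH] th' ph.
  by apply: cvg_test_eq (cvg_test_cos th' ph) => x; rewrite expr0 mul1r.
apply: cvg_test_eq (cvg_testD (cvg_testZ 2^-1 (IH (th + th') (ph - pi / 2)))
  (cvg_testZ 2^-1 (IH (th - th') (- ph - pi / 2)))) => x.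
rewrite !addrA !cosBpihalf exprSr -!mulrA.
have -> : (th + th') * x + ph = th * x + (th' * x + ph) by ring.
have -> : (th - th') * x - ph = th * x - (th' * x + ph) by ring.
by rewrite sinD sinB; field.
Qed.

Lemma cvg_test_poly_sin (th : R) (p : {poly R}) :
  cvg_test (fun x : TR => p.[sin (th * (x : R))]).
Proof.
under eq_fun do rewrite horner_coef.
elim: (size p) => [|n IH].
  by under eq_fun do rewrite big_ord0; exact: cvg_test_cst.
under eq_fun do rewrite big_ord_recr/=.
apply: cvg_testD => //; apply: cvg_testZ.
by apply: cvg_test_eq (cvg_test_sin_cos th n 0 0) => x; rewrite mul0r addr0 cos0 mulr1.
Qed.

Lemma cvg_test_uniform h : bounded_mfun h ->
  (forall e, 0 < e -> exists2 g, cvg_test g & forall x, `|h x - g x| <= e) ->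
  cvg_test h.
Proof.
move=> hb hg; split => //; apply/cvgrPdist_le => e e0.
have e3 : 0 < e / 3 by rewrite divr_gt0.
have [g [gb cg] gh] := hg _ e3.
have /cvgrPdist_le/(_ _ e3) := cg; apply: filterS => n H.
apply: le_trans (ler_distD (\int[mu]_x g x) _ _) _.
rewrite [leRHS](_ : e = e / 3 + (e / 3 + e / 3)); last by field.
apply: lerD; first exact: bounded_Rintegral_dist.
apply: le_trans (ler_distD (\int[mu_ n]_x g x) _ _) _.
by apply: lerD => //; rewrite distrC; exact: bounded_Rintegral_dist.
Qed.

Lemma cvg_test_abs_sin (th b : R) : `|b| <= 1 ->
  cvg_test (fun x : TR => `|b - sin (th * (x : R))|).
Proof.
move=> b1.
(* The difference ranges over [-2, 2]; halving brings it into [-1, 1], where the polynomial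
   approximation of the absolute value holds. *)
have H : cvg_test (fun x : TR => `|(b - sin (th * (x : R))) / 2|).
  apply: cvg_test_uniform.
    apply: bounded_mfun_norm; split.
      apply: measurable_funM => //; apply: measurable_funB => //.
      apply: (measurableT_comp (f := @sin R)).
  by apply: continuous_measurable_fun; exact: continuous_sin.
      exact: measurable_funM.
    exists 1 => x; have := sin_max (th * x); have := b1.
    by rewrite !ler_norml; lra.
  move=> e e0; have [p Hp] := @abs_poly_approx R e e0.
  exists (fun x : TR => (p \Po (2^-1 *: (b%:P - 'X))).[sin (th * (x : R))]).
    exact: cvg_test_poly_sin.
  move=> x; rewrite horner_comp !hornerE mulrC; apply: Hp.
  by have := sin_max (th * x); have := b1; rewrite !ler_norml; lra.
apply: cvg_test_eq (cvg_testZ 2 H) => x.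
by rewrite normrM (@ger0_norm _ 2^-1)//; field.
Qed.

End TrigonometricConvergence.

(** * From trigonometric moments to distribution functions *)

Section Ramp.
Context {R : realType}.
Implicit Types s x y z K : R.

(** The affine ramp from 1 at s0 down to 0 at s1, constant outside, written with absolute values
    only so that [cvg_test_abs_sin] applies to it. *)
Definition ramp s0 s1 s : R := (`|s1 - s| - `|s0 - s| + (s1 - s0)) / (2 * (s1 - s0)).

Lemma ramp_left s0 s1 s : s0 < s1 -> s <= s0 -> ramp s0 s1 s = 1.
Proof.
move=> s01 ss; rewrite /ramp !ger0_norm ?subr_ge0//; last by rewrite (le_trans ss)// ltW.
by field; rewrite subr_eq0 gt_eqF.
Qed.

Lemma ramp_right s0 s1 s : s0 < s1 -> s1 <= s -> ramp s0 s1 s = 0.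
Proof.
move=> s01 ss; rewrite /ramp !ler0_norm ?subr_le0//; last by rewrite (le_trans _ ss)// ltW.
by rewrite (_ : _ + _ = 0) ?mul0r//; ring.
Qed.

Lemma ramp01 s0 s1 s : s0 < s1 -> 0 <= ramp s0 s1 s <= 1.
Proof.
move=> s01; have d0 : 0 < s1 - s0 by rewrite subr_gt0.
have [ss|ss] := leP s s0; first by rewrite ramp_left// ler01 lexx.
have [ss'|ss'] := leP s1 s; first by rewrite ramp_right// ler01 lexx.
rewrite /ramp gtr0_norm ?subr_gt0// ltr0_norm ?subr_lt0//.
by rewrite ler_pdivrMr ?mulr_gt0// mul1r divr_ge0 ?mulr_ge0 ?(ltW d0)//=; lra.
Qed.

Definition sin_ramp x z K y : R :=
  let th := pi / 2 / K in ramp (sin (th * x)) (sin (th * z)) (sin (th * y)).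

(** The factor maps [-K, K] onto [- pi / 2, pi / 2], where the sine is increasing. *)
Lemma sin_scaled_lt K x y : `|x| <= K -> `|y| <= K -> 0 < K -> x < y ->
  sin (pi / 2 / K * x) < sin (pi / 2 / K * y).
Proof.
move=> xK yK K0 xy; have p0 : 0 < pi / 2 :> R by rewrite divr_gt0// pi_gt0.
have H u : `|u| <= K -> pi / 2 / K * u \in `[ - (pi / 2), pi / 2].
  move=> uK; rewrite in_itv/= -ler_norml mulrAC normrM normfV (gtr0_norm K0).
  by rewrite ler_pdivrMr// normrM (gtr0_norm p0) ler_wpM2l// ltW.
by rewrite ltr_sin ?H// ltr_pM2l// divr_gt0.
Qed.

Lemma sin_ramp01 x z K y : 0 < K -> `|x| <= K -> `|z| <= K -> x < z ->
  0 <= sin_ramp x z K y <= 1.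
Proof. by move=> K0 xK zK xz; apply: ramp01; exact: sin_scaled_lt. Qed.

(** Beyond K the periodic ramp is unrelated to the indicator; there both lie in [0, 1], and the
    indicator of the tail pays for the difference. *)
Lemma sin_ramp_ge x z K y : 0 < K -> `|x| <= K -> `|z| <= K -> x < z ->
  \1_`]-oo, x]%classic y <= sin_ramp x z K y + \1_[set u | K <= `|u| ] y :> R.
Proof.
move=> K0 xK zK xz; have /andP[h0 h1] := sin_ramp01 y K0 xK zK xz.
have b1 (b : bool) : b%:R <= 1 :> R by case: b.
rewrite !indicE; have [yK|yK] := leP K `|y|.
  by rewrite [in X in _ + X]mem_set// (le_trans (b1 _))// lerDr.
have [yx|yx] := leP y x.
  rewrite /sin_ramp ramp_left ?sin_scaled_lt//; last first.
    move: yx; rewrite le_eqVlt => /predU1P[->//|yx].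
    by rewrite ltW// sin_scaled_lt// ltW.
  by rewrite (le_trans (b1 _))// lerDl.
rewrite memNset ?addr_ge0//.
by rewrite /= in_itv/= leNgt yx.
Qed.

Lemma sin_ramp_le x z K y : 0 < K -> `|x| <= K -> `|z| <= K -> x < z ->
  sin_ramp x z K y <= \1_`]-oo, z]%classic y + \1_[set u | K <= `|u| ] y :> R.
Proof.
move=> K0 xK zK xz; have /andP[h0 h1] := sin_ramp01 y K0 xK zK xz.
rewrite !indicE; have [yK|yK] := leP K `|y|.
  by rewrite [in X in _ + X]mem_set// (le_trans h1)// lerDr.
have [yz|yz] := leP y z.
  by rewrite [in X in X + _]mem_set ?(le_trans h1) ?lerDl//= in_itv.
by rewrite /sin_ramp ramp_right ?sin_scaled_lt ?addr_ge0// ltW// sin_scaled_lt// ltW.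
Qed.

End Ramp.

(** * Distribution functions from trigonometric moments and tightness *)

Section Levy.
Context {R : realType}.
Local Notation TR := (measurableTypeR R).
Variables (mu_ : nat -> probability TR R) (mu : probability TR R).
Hypothesis mu_cos : forall th ph : R,
  \int[mu_ n]_x cos (th * (x : R) + ph) @[n --> \oo] --> \int[mu]_x cos (th * (x : R) + ph).

Let tail (K : R) : set TR := [set u : TR | K <= `|u : R| ].
Let low (x : R) : set TR := `]-oo, x]%classic.

Let measurable_tail K : measurable (tail K).
Proof.
rewrite (_ : tail K = (@Num.norm R R) @^-1` `[K, +oo[%classic); last first.
  by apply/seteqP; split => u; rewrite /tail/= in_itv/= andbT.
by rewrite -[X in measurable X]setTI; apply: (@normr_measurable R setT).
Qed.

Let measurable_low x : measurable (low x).
Proof. exact: measurable_itv. Qed.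

Lemma cvg_test_sin_ramp (x z K : R) : cvg_test mu_ mu (sin_ramp x z K).
Proof.
rewrite /sin_ramp /ramp; set th := pi / 2 / K.
set s0 := sin (th * x); set s1 := sin (th * z).
have g1 := cvg_test_abs_sin mu_cos th (sin_max (th * z)).
have g0 := cvg_test_abs_sin mu_cos th (sin_max (th * x)).
apply: cvg_test_eq (cvg_testZ (2 * (s1 - s0))^-1 (cvg_testD g1 (cvg_testD (cvg_testZ (-1) g0)
  (cvg_test_cst mu_ mu (s1 - s0))))) => y.
by rewrite mulN1r addrA [LHS]mulrC.
Qed.

Lemma Rintegral_sin_ramp_ge (nu : probability TR R) (x z K : R) :
  0 < K -> `|x| <= K -> `|z| <= K -> x < z ->
  fine (nu (low x)) <= \int[nu]_y sin_ramp x z K y + fine (nu (tail K)).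
Proof.
move=> K0 xK zK xz.
rewrite -!(@Rintegral_probability_indic _ TR)// -bounded_RintegralD//; last 2 first.
- by have [] := cvg_test_sin_ramp x z K.
- exact: bounded_mfun_indic.
apply: le_bounded_Rintegral => [||y]; first exact: bounded_mfun_indic.
  apply: bounded_mfunD; first by have [] := cvg_test_sin_ramp x z K.
  exact: bounded_mfun_indic.
exact: sin_ramp_ge.
Qed.

Lemma Rintegral_sin_ramp_le (nu : probability TR R) (x z K : R) :
  0 < K -> `|x| <= K -> `|z| <= K -> x < z ->
  \int[nu]_y sin_ramp x z K y <= fine (nu (low z)) + fine (nu (tail K)).
Proof.
move=> K0 xK zK xz.
rewrite -!(@Rintegral_probability_indic _ TR)// -bounded_RintegralD//.
- apply: le_bounded_Rintegral => [||y]; first by have [] := cvg_test_sin_ramp x z K.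
    by apply: bounded_mfunD; exact: bounded_mfun_indic.
  exact: sin_ramp_le.
- exact: bounded_mfun_indic.
- exact: bounded_mfun_indic.
Qed.

(** Continuity from above: the tails decrease to the empty set. *)
Lemma tail_vanishes e : 0 < e -> exists K0 : R, forall K, K0 <= K ->
  fine (mu (tail K)) <= e.
Proof.
move=> e0.
have H : mu (tail n%:R) @[n --> \oo] --> 0%E.
  rewrite -(measure0 mu) (_ : set0 = \bigcap_n tail n%:R); last first.
    apply/seteqP; split => // y /(_ (Num.bound `|y : R|) I).
    rewrite /tail/= => h; have := archi_boundP (normr_ge0 (y : R)).
    by rewrite ltNge h.
  apply: nonincreasing_cvg_mu => //.
  - by rewrite (le_lt_trans (probability_le1 _ _)) ?ltry.
  - exact: bigcap_measurable.
  - move=> m n mn; apply/subsetPset => y; rewrite /tail/=; apply: le_trans.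
    by rewrite ler_nat.
have /fine_cvgP[_ /cvgrPdist_le/(_ _ e0)[N _ HN]] := H.
exists N%:R => K NK.
apply: le_trans (le_trans _ (HN N (leqnn N))).
  apply: (@fine_le _ (mu (tail K)) (mu (tail N%:R))); rewrite ?fin_num_measure//.
  apply: le_measure; rewrite ?inE//.
  by move=> y; rewrite /tail/=; apply: le_trans.
by rewrite /= sub0r normrN ger0_norm// fine_ge0.
Qed.

Hypothesis tight : exists C : R, forall n K, (0 < n)%N -> 0 < K ->
  fine (mu_ n (tail K)) <= C / K.

(** Ramps over [x, x + del] and [x - del, x] bound the distribution functions from above and below.
    Four errors of e / 4 arise: the continuity of the limit at x, the convergence of the ramp
    integrals, and the tails of both laws. *)
Lemma levy_cdf (x : R) : {for x, continuous (fun x : R => mu (low x))} ->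
  mu_ n (low x) @[n --> \oo] --> mu (low x).
Proof.
have fnu (nu : probability TR R) A : measurable A -> nu A \is a fin_num.
  by move=> mA; exact: fin_num_measure.
move=> Fx; rewrite -(fineK (fnu mu _ (measurable_low x)));
apply/fine_cvgP; split; first by apply: nearW => n; exact: fnu.
have {Fx} : fine (mu (low y)) @[y --> x] --> fine (mu (low x)).
  by apply: fine_cvg; rewrite fineK ?fnu.
move=> /cvgrPdist_le Fx; apply/cvgrPdist_le => e e0.
have e4 : 0 < e / 4 by rewrite divr_gt0.
have [/= dl dl0 Hdl] := Fx _ e4.
pose del := dl / 2; have del0 : 0 < del by rewrite divr_gt0.
have deldl : del < dl by rewrite /del; lra.
have Hp : fine (mu (low (x + del))) <= fine (mu (low x)) + e / 4.
  have : ball x dl (x + del) by rewrite /ball/= opprD addNKr normrN gtr0_norm.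
  by move=> /Hdl /=; rewrite ler_distl => /andP[+ _]; lra.
have Hm : fine (mu (low x)) - e / 4 <= fine (mu (low (x - del))).
  have : ball x dl (x - del) by rewrite /ball/= subKr gtr0_norm.
  by move=> /Hdl /=; rewrite ler_distl => /andP[_ +]; lra.
have [K0 HK0] := tail_vanishes e4.
have [C HC] := tight.
(* The summands make K exceed [K0], put x and x +- del into [-K, K], and bring C / K below e / 4. *)
pose K := `|K0| + `|x| + del + `|C| / (e / 4).
have C0 : 0 <= `|C| / (e / 4) by rewrite divr_ge0// ltW.
have K00 : 0 < K by rewrite /K; have := normr_ge0 K0; have := normr_ge0 x; lra.
have muK : fine (mu (tail K)) <= e / 4.
  apply: HK0; have := ler_norm K0; have := normr_ge0 x; rewrite /K; lra.
have munK n : (0 < n)%N -> fine (mu_ n (tail K)) <= e / 4.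
  move=> n0; apply: le_trans (HC n K n0 K00) _.
  rewrite ler_pdivrMr// mulrC -ler_pdivrMr//.
  apply: (@le_trans _ _ (`|C| / (e / 4))); first by rewrite ler_pM2r ?invr_gt0// ler_norm.
  by rewrite /K; have := normr_ge0 K0; have := normr_ge0 x; lra.
have xK : `|x| <= K by have := normr_ge0 K0; rewrite /K; lra.
have xpK : `|x + del| <= K.
  rewrite (le_trans (ler_normD _ _))// (gtr0_norm del0) /K.
  by have := normr_ge0 K0; lra.
have xmK : `|x - del| <= K.
  rewrite (le_trans (ler_normB _ _))// (gtr0_norm del0) /K.
  by have := normr_ge0 K0; lra.
have xp : x < x + del by rewrite ltrDl.
have xm : x - del < x by rewrite gtrBl.
have [_ /cvgrPdist_le/(_ _ e4) cp] := cvg_test_sin_ramp x (x + del) K.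
have [_ /cvgrPdist_le/(_ _ e4) cm] := cvg_test_sin_ramp (x - del) x K.
near=> n.
have n0 : (0 < n)%N by near: n; exact: nbhs_infty_gt.
have /= := munK n n0.
have : `|\int[mu]_y sin_ramp x (x + del) K y - \int[mu_ n]_y sin_ramp x (x + del) K y| <= e / 4.
  by near: n.
have : `|\int[mu]_y sin_ramp (x - del) x K y - \int[mu_ n]_y sin_ramp (x - del) x K y| <= e / 4.
  by near: n.
have := Rintegral_sin_ramp_ge (mu_ n) K00 xK xpK xp.
have := Rintegral_sin_ramp_le mu K00 xK xpK xp.
have := Rintegral_sin_ramp_le (mu_ n) K00 xmK xK xm.
have := Rintegral_sin_ramp_ge mu K00 xmK xK xm.
by rewrite !ler_norml; lra.
Unshelve. all: end_near. Qed.

End Levy.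

(** * Trigonometric moments of the normal law *)

Section GaussianCharacteristic.
Context {R : realType}.
Local Notation mu := (@lebesgue_measure R).
Variable s : R.
Hypothesis s0 : s != 0.
Implicit Types x th ph : R.

Local Notation w := (normal_fun 0 s).

Let s2 : 0 < s ^+ 2. Proof. by rewrite exprn_even_gt0. Qed.

Lemma integrable_normal_fun (t : R) : t != 0 ->
  mu.-integrable [set: R] (EFin \o normal_fun 0 t).
Proof.
move=> t0; have p0 := normal_peak_gt0 t0.
rewrite (_ : EFin \o _ = fun x => ((normal_peak t)^-1%:E * (normal_pdf 0 t x)%:E)%E).
  by apply: integrableZl => //; exact: integrable_normal_pdf.
apply/funext => x; rewrite normal_pdfE// -EFinM mulrA mulVf ?gt_eqF// mul1r//.
Qed.

(** Half of the Gaussian exponent absorbs the factor |x|: with u = x^2 / (4 s^2), |x| <= |s| (1 + u)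
    is a completed square, and (1 + u) e^(-u) <= 1. The other half is a Gaussian of doubled
    variance. *)
Lemma norm_mul_normal_fun_le x :
  `|x| * w x <= `|s| * normal_fun 0 (s * Num.sqrt 2) x.
Proof.
rewrite /normal_fun !subr0 exprMn sqr_sqrtr//.
set u := x ^+ 2 / (s ^+ 2 * 2 *+ 2).
have -> : - x ^+ 2 / (s ^+ 2 *+ 2) = - u + - u.
  by rewrite /u; field; rewrite s0.
have -> : - x ^+ 2 / (s ^+ 2 * 2 *+ 2) = - u by rewrite /u mulNr.
rewrite expRD mulrA ler_wpM2r ?expR_ge0//.
have s0' : 0 < `|s| by rewrite normr_gt0.
have h : `|x| <= `|s| * (1 + u).
  rewrite /u -(real_normK (num_real s)) -(real_normK (num_real x)) -subr_ge0.
  move: `|x| => y; rewrite (_ : _ - _ = (y - 2 * `|s|) ^+ 2 / (4 * `|s|)).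
    by rewrite divr_ge0 ?sqr_ge0// mulr_ge0.
  by field; rewrite gt_eqF.
apply: le_trans (ler_wpM2r (expR_ge0 _) h) _.
rewrite -mulrA ler_piMr//.
apply: le_trans (ler_wpM2r (expR_ge0 _) (expR_ge1Dx u)) _.
by rewrite expRxMexpNx_1.
Qed.

Lemma integrable_mul_normal_fun :
  mu.-integrable [set: R] (EFin \o (fun x => `|x| * w x)).
Proof.
have t0 : s * Num.sqrt 2 != 0 by rewrite mulf_neq0// gt_eqF// sqrtr_gt0.
apply: (le_integrable measurableT _ _ (integrableZl measurableT `|s| (integrable_normal_fun t0))).
  apply/measurable_EFinP; apply: measurable_funM; last exact: measurable_normal_fun.
  exact: normr_measurable.
move=> x _; rewrite /= lee_fin !normrM !normr_id !(ger0_norm (normal_fun_ge0 _ _ _)).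
exact: norm_mul_normal_fun_le.
Qed.

Lemma is_derive_normal_fun x : is_derive x 1 w (- (x / s ^+ 2) * w x).
Proof.
rewrite /normal_fun.
have h : is_derive x 1 (fun x => - (x - 0) ^+ 2 / (s ^+ 2 *+ 2)) (- (x / s ^+ 2)).
  by apply: is_derive_eq; rewrite /GRing.scale/=; field.
by apply: is_derive_eq; rewrite /GRing.scale/= mulrC.
Qed.

Lemma is_derive_sin_normal_fun th ph x :
  is_derive x 1 (fun x => sin (th * x + ph) * w x)
    (th * (cos (th * x + ph) * w x) - (s ^+ 2)^-1 * (x * sin (th * x + ph) * w x)).
Proof.
have h1 : is_derive x 1 (fun x => th * x + ph) th.
  by apply: is_derive_eq; rewrite /GRing.scale/= mulr1 addr0.
have h2 : is_derive x 1 (fun x => sin (th * x + ph)) (th * cos (th * x + ph)).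
  by apply: is_derive_eq; rewrite /GRing.scale/= mulrC.
have h3 := is_derive_normal_fun x.
by apply: is_derive_eq; rewrite /GRing.scale/=; ring.
Qed.

Let dF th ph x : R :=
  th * (cos (th * x + ph) * w x) - (s ^+ 2)^-1 * (x * sin (th * x + ph) * w x).

Let continuous_dF th ph : continuous (dF th ph).
Proof.
move=> x; apply: differentiable_continuous; apply/derivable1_diffP.
have h0 : is_derive x 1 (fun x => th * x + ph) th.
  by apply: is_derive_eq; rewrite /GRing.scale/= mulr1 addr0.
have h1 : is_derive x 1 (fun x => sin (th * x + ph)) (th * cos (th * x + ph)).
  by apply: is_derive_eq; rewrite /GRing.scale/= mulrC.
have h2 : is_derive x 1 (fun x => cos (th * x + ph)) (- th * sin (th * x + ph)).
  by apply: is_derive_eq; rewrite /GRing.scale/=; ring.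
by have h3 := is_derive_normal_fun x; rewrite /dF.
Qed.

Let measurable_affine th ph : measurable_fun [set: R] (fun x : R => th * x + ph).
Proof. by apply: measurable_funD => //; exact: measurable_funM. Qed.

Let measurable_cosM th ph : measurable_fun [set: R] (fun x : R => cos (th * x + ph)).
Proof.
apply: (measurableT_comp (f := @cos R)); last exact: measurable_affine.
by apply: continuous_measurable_fun; exact: continuous_cos.
Qed.

Let measurable_sinM th ph : measurable_fun [set: R] (fun x : R => sin (th * x + ph)).
Proof.
apply: (measurableT_comp (f := @sin R)); last exact: measurable_affine.
by apply: continuous_measurable_fun; exact: continuous_sin.
Qed.

Lemma integrable_cos_normal_fun th ph :
  mu.-integrable [set: R] (EFin \o (fun x => cos (th * x + ph) * w x)).
Proof.
apply: (le_integrable measurableT _ _ (integrable_normal_fun s0)).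
  apply/measurable_EFinP; apply: measurable_funM; last exact: measurable_normal_fun.
  exact: measurable_cosM.
move=> x _; rewrite /= lee_fin normrM ler_piMl// cos_max//.
Qed.

Lemma integrable_mul_sin_normal_fun th ph :
  mu.-integrable [set: R] (EFin \o (fun x => x * sin (th * x + ph) * w x)).
Proof.
apply: (le_integrable measurableT _ _ integrable_mul_normal_fun).
  apply/measurable_EFinP; apply: measurable_funM; last exact: measurable_normal_fun.
  by apply: measurable_funM => //; exact: measurable_sinM.
move=> x _; rewrite /= lee_fin !normrM normr_id ler_wpM2r// ler_piMr// sin_max//.
Qed.

Let integrable_dF th ph : mu.-integrable [set: R] (EFin \o dF th ph).
Proof.
rewrite /dF /comp; under eq_fun do rewrite EFinB !EFinM.
apply: integrableB => //; apply: integrableZl => //.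
- exact: integrable_cos_normal_fun.
- exact: integrable_mul_sin_normal_fun.
Qed.

Lemma cvg_integral_symitv (f : R -> R) : mu.-integrable [set: R] (EFin \o f) ->
  \int[mu]_(x in `[- n.+1%:R, n.+1%:R]) f x @[n --> \oo] --> \int[mu]_x f x.
Proof.
move=> fi; rewrite /Rintegral; apply: fine_cvg.
rewrite fineK; last exact: integrable_fin_num.
under eq_fun do rewrite integral_mkcond.
have mf : measurable_fun [set: R] (EFin \o f) by exact: measurable_int fi.
have [] := @dominated_convergence _ _ _ mu setT measurableT
  (fun n => (EFin \o f) \_ `[- n.+1%:R, n.+1%:R]%classic) (EFin \o f) (abse \o (EFin \o f)).
- by move=> n; apply/(measurable_restrictT _ _).1 => //; exact: measurable_funTS.
- exact: mf.
- apply: aeW => x _; apply: cvg_near_cst; near=> n.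
  rewrite patchE mem_set// /= in_itv/= -ler_norml.
  have : `|x| <= n%:R by near: n; exact: nbhs_infty_ger.
  by move=> /le_trans; apply; rewrite ler_nat.
- exact: integrable_abse.
- apply: aeW => x n _; rewrite patchE; case: ifP => //= _.
  by rewrite normr0 lee_fin.
- by [].
Unshelve. all: end_near. Qed.

(** [dF] is the derivative of F = sin (th x + ph) w. On a symmetric interval its integral is a
    boundary term, of order 1 / n because |x| w(x) <= |s|. *)
Lemma Rintegral_dF0 th ph : \int[mu]_x dF th ph x = 0.
Proof.
set F := fun x => sin (th * x + ph) * w x.
have dFE x : is_derive x 1 F (dF th ph x) by exact: is_derive_sin_normal_fun.
have cF : continuous F.
  by move=> x; apply: differentiable_continuous; apply/derivable1_diffP.
have H n : \int[mu]_(x in `[- n.+1%:R, n.+1%:R]) dF th ph x = F n.+1%:R - F (- n.+1%:R).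
  rewrite /Rintegral (@continuous_FTC2 R _ F)//.
  - by rewrite gtrN// ltr0n.
  - by apply: continuous_subspaceT => x; exact: continuous_dF.
  - split => [x _||]; first by [].
      by apply: cvg_at_right_filter; exact: cF.
    by apply: cvg_at_left_filter; exact: cF.
  - by move=> x _; rewrite derive1E derive_val.
have := cvg_integral_symitv (integrable_dF th ph).
under eq_fun do rewrite H.
move=> /cvg_lim <- //; apply/cvg_lim => //.
pose C := `|s| * 2.
apply: norm_cvg0.
apply: (@squeeze_cvgr _ _ _ _ (cst 0) (fun n => C * n.+1%:R^-1)).
- apply: nearW => n; rewrite normr_ge0/=.
  have B (y : R) : `|y| = n.+1%:R -> `|F y| <= `|s| * n.+1%:R^-1.
    move=> yn; rewrite /F normrM (le_trans (ler_piMl _ (sin_max _)))//.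
    rewrite ger0_norm ?normal_fun_ge0// ler_pdivlMr// -yn mulrC.
    apply: le_trans (norm_mul_normal_fun_le y) _.
    rewrite ler_piMr// /normal_fun expR_le1 mulNr oppr_le0.
    by rewrite divr_ge0 ?sqr_ge0// mulrn_wge0// sqr_ge0.
  rewrite (le_trans (ler_normB _ _))// /C mulrAC.
  have : `|F n.+1%:R| <= `|s| * n.+1%:R^-1 by apply: B; rewrite normr_nat.
  have : `|F (- n.+1%:R)| <= `|s| * n.+1%:R^-1 by apply: B; rewrite normrN normr_nat.
  by move: (_ * n.+1%:R^-1) (`|F _|) (`|F _|) => a b c; lra.
- exact: cvg_cst.
- rewrite -[X in _ --> X](mulr0 C); apply: cvgM; first exact: cvg_cst.
  exact: cvg_harmonic.
Qed.

(** Stein's identity E[Z f(Z)] = s^2 E[f'(Z)] for f(x) = sin (th x + ph), with the unnormalized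
    density. *)
Lemma Rintegral_by_parts th ph :
  \int[mu]_x (x * sin (th * x + ph) * w x) =
  s ^+ 2 * th * \int[mu]_x (cos (th * x + ph) * w x).
Proof.
have := Rintegral_dF0 th ph; rewrite /dF RintegralB//; last 2 first.
- rewrite /comp; under eq_fun do rewrite EFinM.
  by apply: integrableZl => //; exact: integrable_cos_normal_fun.
- rewrite /comp; under eq_fun do rewrite EFinM.
  by apply: integrableZl => //; exact: integrable_mul_sin_normal_fun.
rewrite !RintegralZl//; last 2 first.
- exact: integrable_mul_sin_normal_fun.
- exact: integrable_cos_normal_fun.
move=> /eqP; rewrite subr_eq0 => /eqP h.
by rewrite -mulrA h mulrA mulfV ?mul1r// gt_eqF.
Qed.

Let Phi ph th := \int[mu]_x (cos (th * x + ph) * w x).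

(** Differentiation under the integral, dominated by |x| w(x); Stein's identity then closes the
    formula into a linear differential equation in [th]. *)
Let is_derive_Phi ph th : is_derive th 1 (Phi ph) (- (s ^+ 2 * th) * Phi ph th).
Proof.
pose f (t x : R) := cos (t * x + ph) * w x.
have df (t x : R) : is_derive t 1 (f ^~ x) (- (x * sin (t * x + ph) * w x)).
  have h0 : is_derive t 1 (fun t => t * x + ph) x.
    by apply: is_derive_eq; rewrite /GRing.scale/=; ring.
  have h2 : is_derive t 1 (fun t => cos (t * x + ph)) (- x * sin (t * x + ph)).
    by apply: is_derive_eq; rewrite /GRing.scale/=; ring.
  by apply: is_derive_eq; rewrite /GRing.scale/=; ring.
have d1f (t x : R) : partial1of2 f t x = - (x * sin (t * x + ph) * w x).
  by rewrite partial1of2E derive_val.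
have Ia : `]th - 1, th + 1[%classic th by rewrite /= in_itv/=; apply/andP; split; lra.
have intf t : `]th - 1, th + 1[%classic t -> mu.-integrable setT (EFin \o f t).
  by move=> _; exact: integrable_cos_normal_fun.
have derf t x : `]th - 1, th + 1[%classic t -> setT x -> derivable (f ^~ x) t 1 by [].
have G0 (x : R) : 0 <= `|x| * w x by rewrite mulr_ge0 ?normal_fun_ge0.
have Gub t x : `]th - 1, th + 1[%classic t -> setT x -> `|partial1of2 f t x| <= `|x| * w x.
  move=> _ _; rewrite d1f normrN !normrM ler_pM ?mulr_ge0//.
    by rewrite ler_piMr// sin_max.
  by rewrite ger0_norm ?normal_fun_ge0.
have D1 := derivable_under_integral measurableT Ia intf derf G0 integrable_mul_normal_fun Gub.
have D2 := differentiation_under_integral measurableT Ia intf derf G0 integrable_mul_normal_fun Gub.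
apply: DeriveDef; first exact: D1.
rewrite -derive1E [LHS]D2.
under eq_Rintegral do rewrite d1f -mulN1r.
rewrite RintegralZl//; last exact: integrable_mul_sin_normal_fun.
by rewrite Rintegral_by_parts mulN1r mulNr.
Qed.

Lemma Rintegral_cos_normal_fun th ph : \int[mu]_x (cos (th * x + ph) * w x) =
  expR (- (th ^+ 2 / 2 * s ^+ 2)) * cos ph * \int[mu]_x w x.
Proof.
(* The integrating factor of that equation: the product [Phi ph t * E t] has derivative 0. *)
pose E t := expR (s ^+ 2 / 2 * t ^+ 2).
have dE (t : R) : is_derive t 1 E (s ^+ 2 * t * E t).
  have h0 : is_derive t 1 (fun t => s ^+ 2 / 2 * t ^+ 2) (s ^+ 2 * t).
    by apply: is_derive_eq; rewrite /GRing.scale/=; field.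
  by apply: is_derive_eq; rewrite /GRing.scale/= mulrC.
have H : Phi ph th * E th = Phi ph 0 * E 0.
  apply: (@is_derive_0_is_cst _ (fun t => Phi ph t * E t)) => t.
  have h := is_derive_Phi ph t.
  by apply: is_derive_eq; rewrite /GRing.scale/=; ring.
have E0 : E 0 = 1 by rewrite /E expr0n mulr0 expR0.
have P0 : Phi ph 0 = cos ph * \int[mu]_x w x.
  rewrite /Phi; under eq_Rintegral do rewrite mul0r add0r.
  by rewrite RintegralZl//; exact: integrable_normal_fun.
rewrite E0 P0 mulr1 in H.
rewrite -mulrA -H /E mulrCA -expRD (_ : _ + _ = 0) ?expR0 ?mulr1//.
by field.
Qed.

(** The Radon-Nikodym derivative and the density have the same integral over every measurable set,
    hence agree almost everywhere. *)
Lemma integral_normal_prob (f : R -> \bar R) :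
  (normal_prob 0 s).-integrable [set: measurableTypeR R] f ->
  (\int[normal_prob 0 s]_x f x = \int[mu]_x (f x * (normal_pdf 0 s x)%:E))%E.
Proof.
move=> fi; have dom := @normal_prob_dominates R 0 s.
rewrite -(Radon_Nikodym_change_of_variables dom)//=.
apply: ae_eq_integral => //.
- apply: emeasurable_funM; first exact: measurable_int fi.
  by apply: (measurable_int mu); exact: Radon_Nikodym_integrable.
- apply: emeasurable_funM; first exact: measurable_int fi.
  by apply/measurable_EFinP; exact: measurable_normal_pdf.
- apply: ae_eqe_mul2l; apply: integral_ae_eq => //.
  + by apply: Radon_Nikodym_integrable.
  + by apply/measurable_EFinP; exact: measurable_normal_pdf.
  + by move=> E _ mE; rewrite -Radon_Nikodym_integral.
Qed.

End GaussianCharacteristic.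

Lemma normal_law_cos {R : realType} (v th ph : R) : 0 <= v ->
  \int[normal_law 0 v]_x cos (th * x + ph) = expR (- (th ^+ 2 / 2 * v)) * cos ph.
Proof.
move=> v0; rewrite /normal_law; case: eqVneq => [->|vn0].
  rewrite mulr0 oppr0 expR0 mul1r /Rintegral integral_dirac//.
    by rewrite diracT mul1e mulr0 add0r.
  by apply/measurable_EFinP; have [] := @bounded_mfun_cos R th ph.
have s0 : Num.sqrt v != 0 by rewrite gt_eqF// sqrtr_gt0 lt_neqAle eq_sym vn0.
rewrite /Rintegral integral_normal_prob//; last first.
  exact/bounded_mfun_integrable/bounded_mfun_cos.
rewrite normal_pdfE//.
under eq_integral do rewrite -EFinM mulrCA.
have := @Rintegral_cos_normal_fun R _ s0 th ph; rewrite sqr_sqrtr//.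
have i1 := integrable_cos_normal_fun s0 th ph.
have i2 := integrable_normal_fun s0.
have : \int[lebesgue_measure]_x (normal_peak (Num.sqrt v) * normal_fun 0 (Num.sqrt v) x) = 1.
  have := @integral_normal_pdf R 0 (Num.sqrt v).
  by rewrite normal_pdfE// /Rintegral => ->.
rewrite RintegralZl// => h1 h2.
transitivity (\int[lebesgue_measure]_x
    (normal_peak (Num.sqrt v) * (cos (th * x + ph) * normal_fun 0 (Num.sqrt v) x))).
  by [].
by rewrite RintegralZl// h2 mulrCA h1 mulr1.
Qed.

(** * The history chain *)

Section Chain.
Context {R : realType}.
Variables a q s : R.
Implicit Types (f g : seq bool -> R) (t : seq bool) (n m : nat).

(* Histories are listed with the most recent step first; here p = q + a. *)
Definition head_prob t : R :=
  if t is [::] then s else q + a * ((count id t)%:R / (size t)%:R).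

Definition chain_step g t : R :=
  head_prob t * g (true :: t) + (1 - head_prob t) * g (false :: t).

(** The tower property as a definition: the last step is averaged out first, so an induction on n
    reduces each estimate to one [chain_step]. *)
Fixpoint chain_exp n g : R :=
  if n is m.+1 then chain_exp m (chain_step g) else g [::].

Hypothesis q01 : 0 <= q <= 1.
Hypothesis p01 : 0 <= q + a <= 1.
Hypothesis s01 : 0 <= s <= 1.

Lemma head_prob01 t : 0 <= head_prob t <= 1.
Proof.
case: t => [|b t]//; rewrite /head_prob; set x := _ / _.
have x0 : 0 <= x by rewrite divr_ge0.
have x1 : x <= 1 by rewrite ler_pdivrMr// mul1r ler_nat count_size.
have := q01; have := p01; nra.
Qed.

Lemma chain_exp_le n f g : (forall t, size t = n -> f t <= g t) ->
  chain_exp n f <= chain_exp n g.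
Proof.
elim: n f g => [|n IH] f g fg /=; first exact: fg.
apply: IH => t tn; have /andP[h0 h1] := head_prob01 t.
by rewrite /chain_step lerD// ler_wpM2l ?subr_ge0// fg//= tn.
Qed.

Lemma chain_exp_eq n f g : (forall t, size t = n -> f t = g t) ->
  chain_exp n f = chain_exp n g.
Proof.
by move=> fg; apply/eqP; rewrite eq_le; apply/andP; split;
  apply: chain_exp_le => t /fg ->.
Qed.

Lemma chain_exp_lin n x y f g : chain_exp n (fun t => x * f t + y * g t) =
  x * chain_exp n f + y * chain_exp n g.
Proof.
elim: n f g => [//|n IH] f g /=; rewrite -IH; apply: chain_exp_eq => t _.
by rewrite /chain_step; ring.
Qed.

Lemma chain_exp_cst n x : chain_exp n (fun=> x) = x.
Proof.
elim: n => [//|n IH] /=; rewrite -[RHS]IH; apply: chain_exp_eq => t _.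
by rewrite /chain_step; ring.
Qed.

Lemma chain_expD n f g : chain_exp n (fun t => f t + g t) =
  chain_exp n f + chain_exp n g.
Proof.
rewrite -[X in X + _]mul1r -[X in _ + X]mul1r -chain_exp_lin.
by apply: chain_exp_eq => t _; rewrite !mul1r.
Qed.

Lemma chain_expZ n x f : chain_exp n (fun t => x * f t) = x * chain_exp n f.
Proof.
rewrite -[RHS]addr0 -(mul0r (chain_exp n f)) -chain_exp_lin.
by apply: chain_exp_eq => t _; ring.
Qed.

Lemma chain_exp_dist n f g h : (forall t, size t = n -> `|f t - g t| <= h t) ->
  `|chain_exp n f - chain_exp n g| <= chain_exp n h.
Proof.
move=> fgh; rewrite -mulN1r -[X in X + _]mul1r -chain_exp_lin.
rewrite ler_norml -[- _]mulN1r -chain_expZ; apply/andP; split;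
  by apply: chain_exp_le => t /fgh; rewrite ler_norml => /andP[]; lra.
Qed.

(** * Moments of the deviation from the linear trend *)

Hypothesis a12 : 1 / 2 < a < 1.
Local Notation c := (q / (1 - a)).

Definition deviation t : R := (count id t)%:R - (size t)%:R * c.

Lemma fixpoint01 : 0 <= c <= 1.
Proof.
have a1 : 0 < 1 - a by have := a12; lra.
have := q01; have := p01 => ? ?.
by rewrite ler_pdivrMr// mul1r divr_ge0 ?(ltW a1)//=; lra.
Qed.

Lemma head_probE t : (0 < size t)%N ->
  head_prob t = c + a * (deviation t / (size t)%:R).
Proof.
case: t => // b t _; rewrite /head_prob /deviation.
have : 1 - a != 0 by have := a12; lra.
have : (size (b :: t))%:R != 0 :> R by rewrite pnatr_eq0.
by move: (size _) (count _ _) => m k m0 a0; field; rewrite m0 a0.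
Qed.

Lemma deviation_cons b t : deviation (b :: t) = deviation t + b%:R - c.
Proof. by rewrite /deviation /= natrD -natr1; ring. Qed.

(** Chosen so that the second-moment bound of [chain_exp_deviation_sqr] equals 1 at n = 1. *)
Definition dev_cst : R := 1 + (2 * a - 1)^-1.

Lemma dev_cst_ge1 : 1 <= dev_cst.
Proof. by rewrite lerDl invr_ge0; have := a12; lra. Qed.

(** The cross term 2 D (P - c) equals 2 a D^2 / m by [head_probE]; what remains is the second moment
    of X - c, at most 1. *)
Lemma chain_step_deviation_sqr t : (0 < size t)%N ->
  chain_step (fun t => deviation t ^+ 2) t <=
  (1 + 2 * a / (size t)%:R) * deviation t ^+ 2 + 1.
Proof.
move=> t0; rewrite /chain_step !deviation_cons /=.
have := head_probE t0; have := head_prob01 t; have := fixpoint01.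
move: (head_prob t) (deviation t) c => P D k k01 P01 eP.
have -> : P * (D + 1 - k) ^+ 2 + (1 - P) * (D + 0 - k) ^+ 2 =
  D ^+ 2 + 2 * D * (P - k) + (P * (1 - k) ^+ 2 + (1 - P) * k ^+ 2) by ring.
have -> : P - k = a * (D / (size t)%:R) by rewrite eP; ring.
have H : P * (1 - k) ^+ 2 + (1 - P) * k ^+ 2 <= 1.
  have h1 : (1 - k) ^+ 2 <= 1 by rewrite expr_le1//; lra.
  have h2 : k ^+ 2 <= 1 by rewrite expr_le1//; lra.
  move: h1 h2 P01; move: (_ ^+ 2) (k ^+ 2) => u v; nra.
apply: le_trans (lerD (lexx _) H) _.
by rewrite lerD2r le_eqVlt; apply/orP; left; apply/eqP; ring.
Qed.

(* The linear correction absorbs the additive 1 of chain_step_deviation_sqr. *)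
Lemma chain_exp_deviation_sqr n : (0 < n)%N ->
  chain_exp n (fun t => deviation t ^+ 2) <=
  dev_cst * n%:R `^ (2 * a) - n%:R / (2 * a - 1).
Proof.
have r0 : 0 < 2 * a - 1 by have := a12; lra.
case: n => // n _; elim: n => [|n IH].
  rewrite powR1 mulr1 /dev_cst div1r addrK /= /chain_step /= /deviation /=.
  have := s01; have := fixpoint01; rewrite /=.
  move: c => k k01 h.
  have h1 : (1 - k) ^+ 2 <= 1 by rewrite expr_le1//; lra.
  have h2 : k ^+ 2 <= 1 by rewrite expr_le1//; lra.
  rewrite !addn0 mul1r sub0r sqrrN; move: h1 h2; move: (_ ^+ 2) (k ^+ 2) => u v; nra.
set m := n.+1 in IH *.
have -> : chain_exp m.+1 (fun t => deviation t ^+ 2) =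
  chain_exp m (chain_step (fun t => deviation t ^+ 2)) by [].
have : chain_exp m (chain_step (fun t => deviation t ^+ 2)) <=
    (1 + 2 * a / m%:R) * chain_exp m (fun t => deviation t ^+ 2) + 1.
  rewrite -chain_expZ -[X in _ <= _ + X](chain_exp_cst m) -chain_expD.
  by apply: chain_exp_le => t tm; rewrite -tm; apply: chain_step_deviation_sqr; rewrite tm.
move=> /le_trans; apply.
have a0 : 0 < 1 + 2 * a / m%:R.
  by rewrite addr_gt0// divr_gt0// ?ltr0n//; have := a12; lra.
have := @powR_natS_ge R m (2 * a) isT; rewrite (_ : 1 <= 2 * a); last by have := a12; lra.
move=> /(_ isT) h.
have : (1 + 2 * a / m%:R) * chain_exp m (fun t => deviation t ^+ 2) <=
  (1 + 2 * a / m%:R) * (dev_cst * m%:R `^ (2 * a) - m%:R / (2 * a - 1)).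
  by rewrite ler_wpM2l// ltW.
have : dev_cst * ((1 + 2 * a / m%:R) * m%:R `^ (2 * a)) <= dev_cst * m.+1%:R `^ (2 * a).
  by rewrite ler_wpM2l// (le_trans _ dev_cst_ge1).
have : (1 + 2 * a / m%:R) * (m%:R / (2 * a - 1)) = m%:R / (2 * a - 1) + 2 * a / (2 * a - 1).
  by field; rewrite pnatr_eq0 gt_eqF.
have : m.+1%:R / (2 * a - 1) = m%:R / (2 * a - 1) + (2 * a - 1)^-1.
  by rewrite -natr1 mulrDl mul1r.
have : 2 * a / (2 * a - 1) = 1 + (2 * a - 1)^-1 by field; rewrite gt_eqF.
move: (_ / (_ - 1)) (_ / (_ - 1)) (_ / (_ - 1)) => u v w.
move: (_ `^ _) (_ `^ _) (chain_exp _ _) => x y z.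
lra.
Qed.

Definition dev_cst1 : R := (dev_cst + 1) / 2.

Lemma dev_cst1_ge0 : 0 <= dev_cst1.
Proof. by have := dev_cst_ge1; rewrite /dev_cst1; lra. Qed.

(** |D| <= D^2 / (2 x) + x / 2 with x = n^a, in place of the Cauchy-Schwarz inequality; [dev_cst1]
    is the constant that results. *)
Lemma chain_exp_norm_deviation n : (0 < n)%N ->
  chain_exp n (fun t => `|deviation t|) <= dev_cst1 * n%:R `^ a.
Proof.
move=> n0; set x := n%:R `^ a.
have x0 : 0 < x by rewrite powR_gt0// ltr0n.
have : chain_exp n (fun t => `|deviation t|) <=
    (2 * x)^-1 * chain_exp n (fun t => deviation t ^+ 2) + x / 2.
  rewrite -chain_expZ -[X in _ <= _ + X](chain_exp_cst n) -chain_expD.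
  apply: chain_exp_le => t _.
  rewrite -(real_normK (num_real (deviation t))); move: `|_| => y.
  rewrite -subr_ge0 (_ : _ - _ = (y - x) ^+ 2 / (2 * x)).
    by rewrite divr_ge0 ?sqr_ge0// mulr_ge0// ltW.
  by field; rewrite gt_eqF.
move=> /le_trans; apply.
have := chain_exp_deviation_sqr n0.
have -> : n%:R `^ (2 * a) = x ^+ 2.
  by rewrite -powR_mulrn ?powR_ge0// -powRrM mulrC.
move=> /le_trans -/(_ (dev_cst * x ^+ 2)) h.
have {}h : chain_exp n (fun t => deviation t ^+ 2) <= dev_cst * x ^+ 2.
  by apply: h; rewrite gerBl divr_ge0//; have := a12; lra.
have : (2 * x)^-1 * chain_exp n (fun t => deviation t ^+ 2) <= (2 * x)^-1 * (dev_cst * x ^+ 2).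
  by rewrite ler_wpM2l// invr_ge0 mulr_ge0// ltW.
move=> h1; rewrite -lerBrDr; apply: le_trans h1 _.
rewrite le_eqVlt; apply/orP; left; apply/eqP; rewrite /dev_cst1; field.
by rewrite gt_eqF.
Qed.

(** * Martingale part and drift of the fluctuation *)

Definition weight n m : R := n%:R `^ (a - 1 / 2) / m.+1%:R `^ a.
(** The conditional mean of D_(m+1) is (1 + a / m) D_m; dividing by (m+1)^a multiplies Y_m by 1 +
    [drift m]. *)
Definition drift m : R := (1 + a / m%:R) * (m%:R / m.+1%:R) `^ a - 1.
Definition normalized_dev t : R := deviation t / (size t)%:R `^ a.

(** The tail sum cut off at the length of the history: the step added to a past [u] counts when [u]
    has length at least n. *)
Fixpoint mart_part n t : R :=
  if t is b :: u then
    if (size u < n)%N then 0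
    else mart_part n u - weight n (size u) * (b%:R - head_prob u)
  else 0.

Fixpoint drift_part n t : R :=
  if t is _ :: u then
    if (size u < n)%N then 0
    else drift_part n u -
      n%:R `^ (a - 1 / 2) * (drift (size u) * normalized_dev u)
  else 0.

(** Bernoulli's inequality twice: (1 + 1/m)^a <= 1 + a/m gives the sign, and (1 - 1/(m+1))^a <= 1 -
    a/(m+1) leaves at most a (1 - a) / (m (m+1)). *)
Lemma drift_bound m : (0 < m)%N -> 0 <= drift m <= (m%:R ^+ 2)^-1.
Proof.
move=> m0; have m0' : 0 < m%:R :> R by rewrite ltr0n.
have a0 : 0 < a by have := a12; lra.
have a1 : a < 1 by have := a12; lra.
have a01 : 0 <= a <= 1 by rewrite !ltW.
have e1 : m%:R / m.+1%:R = 1 + - (m.+1%:R)^-1 :> R.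
  by rewrite -natr1; field; lra.
have x0 : 0 <= (m%:R / m.+1%:R) `^ a by exact: powR_ge0.
have am0 : 0 < a / m%:R by rewrite divr_gt0.
apply/andP; split.
  have : (1 + m%:R^-1) `^ a <= 1 + a * m%:R^-1.
    by apply: powR_le1Dx => //; rewrite addr_ge0// invr_ge0 (ltW m0').
  move=> /(ler_wpM2r x0); rewrite -powRM ?divr_ge0//.
  rewrite (_ : _ * (_ / _) = 1) ?powR1; first by rewrite /drift; lra.
  by rewrite -natr1; field; lra.
have : (m%:R / m.+1%:R) `^ a <= 1 + a * - (m.+1%:R)^-1.
  by rewrite e1; apply: powR_le1Dx; rewrite -?e1 ?divr_ge0.
have am1 : 0 <= 1 + a / m%:R by lra.
move=> /(ler_wpM2l am1) h.
rewrite /drift lerBlDr (le_trans h)// -subr_ge0 -natr1.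
rewrite (_ : _ - _ = (1 + m%:R * (1 - a * (1 - a))) / (m%:R ^+ 2 * (m%:R + 1))); last first.
  by field; apply/andP; split; lra.
rewrite divr_ge0// addr_ge0// mulr_ge0//; nra.
Qed.

Lemma normalized_dev_cons b u : (0 < size u)%N -> normalized_dev (b :: u) =
  normalized_dev u + (b%:R - head_prob u) / (size u).+1%:R `^ a
  + drift (size u) * normalized_dev u.
Proof.
move=> u0; rewrite /normalized_dev deviation_cons (head_probE u0) /drift /=.
have := ltr0n R (size u); rewrite u0; move: (size u) (deviation u) c => m D k m0.
have h : (m%:R / m.+1%:R) `^ a = m%:R `^ a / m.+1%:R `^ a.
  by rewrite -powRN powRM ?invr_ge0// -powR_inv1// -powRrM mulN1r.
rewrite h; have : 0 < m%:R `^ a by exact: powR_gt0.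
have : 0 < m.+1%:R `^ a by apply: powR_gt0; rewrite ltr0n.
move: (_ `^ _) (_ `^ _) => x y x0 y0.
by field; rewrite !gt_eqF.
Qed.

(** The increments of Y telescope. As the most recent step comes first, dropping [size t - n]
    entries leaves the history at time n. *)
Lemma mart_drift n t : (0 < n)%N -> (n <= size t)%N ->
  mart_part n t + drift_part n t =
  n%:R `^ (a - 1 / 2) *
    (normalized_dev (drop (size t - n) t) - normalized_dev t).
Proof.
move=> n0; elim: t => [|b u IH]; first by rewrite leqNgt n0.
rewrite [size (b :: u)]/= => nu; have [un|un] := ltnP (size u) n.
  have -> : n = (size u).+1 by apply/eqP; rewrite eqn_leq nu un.
  by rewrite subnn drop0 /= ltnS leqnn subrr mulr0 addr0.
rewrite subSn// /= ltnNge un /= normalized_dev_cons; last exact: leq_trans n0 un.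
have -> : forall w x y z : R, w - x + (y - z) = (w + y) - x - z by move=> *; ring.
by rewrite IH// /weight; ring.
Qed.

(** * Sizes of the weights and the sum of their squares *)

Local Notation r := (2 * a - 1).

Lemma weight_sqr n m : weight n m ^+ 2 = n%:R `^ r / m.+1%:R `^ (2 * a).
Proof.
rewrite /weight exprMn exprVn -!powR_mulrn ?powR_ge0// -!powRrM.
by congr (_ `^ _ / _ `^ _); field.
Qed.

Lemma weight_ge0 n m : 0 <= weight n m.
Proof. by rewrite divr_ge0 ?powR_ge0. Qed.

Lemma weight_le n m : (0 < n)%N -> (n <= m)%N -> weight n m <= n%:R `^ (- (1 / 2)).
Proof.
move=> n0 nm; have n0' : 0 < n%:R :> R by rewrite ltr0n.
rewrite /weight ler_pdivrMr ?powR_gt0 ?ltr0n//.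
rewrite addrC powRD ?(gt_eqF n0') ?implybT// ler_wpM2l ?powR_ge0//.
apply: ge0_ler_powR; rewrite ?nnegrE//; first by have := a12; lra.
by rewrite ler_nat ltnW.
Qed.

Definition weight_sum n N : R := \sum_(n <= m < N) weight n m ^+ 2.

Lemma weight_sum_telescope n N (f : nat -> R) : (n <= N)%N ->
  n%:R `^ r * (f n - f N) = \sum_(n <= m < N) n%:R `^ r * (f m - f m.+1).
Proof.
move=> nN; rewrite -mulr_sumr; congr (_ * _).
rewrite -opprB -(@telescope_sumr R n N f nN) -sumrN.
by apply: eq_bigr => i _; rewrite opprB.
Qed.

Lemma weight_sqrE n m : r * weight n m ^+ 2 =
  n%:R `^ r * (r * m.+1%:R `^ (- (r + 1))).
Proof.
rewrite weight_sqr -powRN (_ : r + 1 = 2 * a); last by ring.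
by ring.
Qed.

(** Comparison with the increments of m^(-r), whose sum gives 1 - (n / N)^r. The lower bound that
    follows uses the sequence shifted by one. *)
Lemma weight_sum_le n N : (0 < n)%N -> (n <= N)%N -> r * weight_sum n N <= 1.
Proof.
move=> n0 nN; have r0 : 0 <= r by have := a12; lra.
apply: (@le_trans _ _ (n%:R `^ r * (n%:R `^ (- r) - N%:R `^ (- r)))).
  rewrite (weight_sum_telescope (fun k => k%:R `^ (- r)))// mulr_sumr.
  apply: ler_sum_nat => m /andP[nm _].
  rewrite weight_sqrE ler_wpM2l ?powR_ge0//.
  by apply: powRN_step_ge => //; exact: leq_trans nm.
rewrite mulrBr -powR_natD// subrr powRr0 gerBl.
by rewrite mulr_ge0 ?powR_ge0.
Qed.

Lemma weight_sum_ge n N : (n <= N)%N ->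
  n%:R `^ r * (n.+1%:R `^ (- r) - N.+1%:R `^ (- r)) <= r * weight_sum n N.
Proof.
move=> nN; have r0 : 0 <= r by have := a12; lra.
rewrite (weight_sum_telescope (fun k => k.+1%:R `^ (- r)))// mulr_sumr.
apply: ler_sum_nat => m /andP[nm _].
by rewrite weight_sqrE ler_wpM2l ?powR_ge0// powRN_step_le.
Qed.

Lemma weight_sumS n N : (n <= N)%N ->
  weight_sum n N.+1 = weight_sum n N + weight n N ^+ 2.
Proof. by move=> nN; rewrite /weight_sum big_nat_recr. Qed.

Lemma weight_sum0 n : weight_sum n n = 0.
Proof. by rewrite /weight_sum big_geq. Qed.

Lemma weight_sum_ge0 n N : 0 <= weight_sum n N.
Proof. by apply: sumr_ge0 => i _; exact: sqr_ge0. Qed.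

Lemma mart_part0 n t : (size t <= n)%N -> mart_part n t = 0.
Proof. by case: t => [//|b u] /= ->. Qed.

Lemma drift_part0 n t : (size t <= n)%N -> drift_part n t = 0.
Proof. by case: t => [//|b u] /= ->. Qed.

Lemma mart_part_cons n b u : (n <= size u)%N -> mart_part n (b :: u) =
  mart_part n u - weight n (size u) * (b%:R - head_prob u).
Proof. by move=> nu /=; rewrite ltnNge nu. Qed.

Lemma drift_part_cons n b u : (n <= size u)%N -> drift_part n (b :: u) =
  drift_part n u - n%:R `^ (a - 1 / 2) * (drift (size u) * normalized_dev u).
Proof. by move=> nu /=; rewrite ltnNge nu. Qed.

Lemma chain_expS N f : chain_exp N.+1 f = chain_exp N (chain_step f).
Proof. by []. Qed.

(** Orthogonality of the increments: the cross term averages to 0 under [chain_step], and the new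
    square contributes P (1 - P) w^2 <= w^2. *)
Lemma chain_exp_mart_sqr n N : (n <= N)%N ->
  chain_exp N (fun t => mart_part n t ^+ 2) <= weight_sum n N.
Proof.
elim: N => [|N IH].
  by rewrite leqn0 => /eqP ->; rewrite weight_sum0 /= expr0n.
rewrite leq_eqVlt => /predU1P[->|]; last rewrite ltnS => nN.
  rewrite weight_sum0 -[leRHS](chain_exp_cst N.+1); apply: chain_exp_le => t tN.
  by rewrite mart_part0 ?tN// expr0n.
rewrite weight_sumS// chain_expS.
apply: le_trans (lerD (IH nN) (lexx _)).
rewrite -[X in _ <= _ + X](chain_exp_cst N) -chain_expD.
apply: chain_exp_le => t tN.
rewrite /chain_step !mart_part_cons ?tN//.
move: (mart_part n t) (weight n N) (head_prob01 t) => M w; move: (head_prob t) => P P01.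
rewrite -subr_ge0 (_ : _ - _ = (1 - P * (1 - P)) * w ^+ 2); last by rewrite /=; ring.
by rewrite mulr_ge0 ?sqr_ge0//; nra.
Qed.

Lemma chain_exp_norm_mart n N : (0 < n)%N -> (n <= N)%N ->
  chain_exp N (fun t => `|mart_part n t|) <= (r^-1 + 1) / 2.
Proof.
move=> n0 nN; have r0 : 0 < r by have := a12; lra.
have : chain_exp N (fun t => `|mart_part n t|) <=
    2^-1 * chain_exp N (fun t => mart_part n t ^+ 2) + 2^-1.
  rewrite -chain_expZ -[X in _ <= _ + X](chain_exp_cst N) -chain_expD.
  apply: chain_exp_le => t _; rewrite -(real_normK (num_real (mart_part n t))).
  by have := sqr_ge0 (`|mart_part n t| - 1); lra.
have := chain_exp_mart_sqr nN; have : weight_sum n N <= r^-1.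
  by rewrite -[leRHS]mul1r ler_pdivlMr// mulrC weight_sum_le.
lra.
Qed.

(** The term of index m is at most C / m^2, because E|D_m| = O(m^a); the bound telescopes thanks to
    1 / m^2 <= 2 / m - 2 / (m+1). *)
Lemma chain_exp_norm_drift n N : (0 < n)%N -> (n <= N)%N ->
  chain_exp N (fun t => `|drift_part n t|) <=
  dev_cst1 * n%:R `^ (a - 1 / 2) * (2 / n%:R - 2 / N%:R).
Proof.
move=> n0; set C := dev_cst1 * _.
have C0 : 0 <= C by rewrite mulr_ge0 ?powR_ge0 ?dev_cst1_ge0.
elim: N => [|N IH]; first by rewrite leqNgt n0.
rewrite leq_eqVlt => /predU1P[->|]; last rewrite ltnS => nN.
  rewrite subrr mulr0 -[leRHS](chain_exp_cst N.+1); apply: chain_exp_le => t tN.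
  by rewrite drift_part0 ?tN// normr0.
have N0 : (0 < N)%N by exact: leq_trans nN.
have N0' : 0 < N%:R :> R by rewrite ltr0n.
set x := n%:R `^ (a - 1 / 2) in C C0 IH *.
have x0 : 0 <= x by exact: powR_ge0.
have Na : 0 < N%:R `^ a :> R by exact: powR_gt0.
have : chain_exp N.+1 (fun t => `|drift_part n t|) <=
    chain_exp N (fun t => `|drift_part n t|) +
    x * (N%:R ^+ 2)^-1 / N%:R `^ a * chain_exp N (fun t => `|deviation t|).
  rewrite chain_expS -chain_expZ -chain_expD; apply: chain_exp_le => t tN.
  rewrite /chain_step !drift_part_cons ?tN// -mulrDl subrKC [leLHS]mul1r.
  rewrite (le_trans (ler_normB _ _))// lerD2l /normalized_dev tN !normrM.
  rewrite normfV (gtr0_norm Na) (ger0_norm x0).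
  rewrite -!mulrA ler_wpM2l// [`|_| / _]mulrC ler_wpM2r//.
  by have /andP[d0 d1] := drift_bound N0; rewrite ger0_norm.
move=> /le_trans; apply.
apply: le_trans (lerD (IH nN) (ler_wpM2l _ (chain_exp_norm_deviation N0))) _.
  by rewrite !mulr_ge0 ?invr_ge0// ?exprn_ge0// ltW.
rewrite (_ : _ * (_ * _ `^ a) = C * (N%:R ^+ 2)^-1); last first.
  by rewrite /C; field; lra.
rewrite -mulrDr ler_wpM2l// -subr_ge0 -natr1.
rewrite (_ : _ - _ = (N%:R - 1) / (N%:R ^+ 2 * (N%:R + 1))); last first.
  by field; rewrite !pnatr_eq0 -!lt0n n0 N0 /=; lra.
rewrite divr_ge0 ?subr_ge0 ?ler1n// mulr_ge0 ?exprn_ge0//; lra.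
Qed.

(** * Cosine moments of the martingale part and of the fluctuation *)

Definition limit_var : R := c * (1 - c).

Lemma limit_var01 : 0 <= limit_var <= 1.
Proof.
have := fixpoint01; rewrite /limit_var; move: c => k /andP[k0 k1].
by apply/andP; split; nra.
Qed.

(** Error per unit of [weight_sum]. Its terms come from the Taylor remainder of the cosine, from the
    conditional variance against its limit, and from replacing 1 - y by e^(-y). *)
Definition clt_error th n : R :=
  2 * `|th| ^+ 3 * n%:R `^ (- (1 / 2)) +
  th ^+ 2 / 2 * (dev_cst1 * n%:R `^ (a - 1)) +
  (th ^+ 2 * limit_var / 2) ^+ 2 / n%:R.

Lemma clt_error_ge0 th n : 0 <= clt_error th n.
Proof.
rewrite /clt_error !addr_ge0//.
- by rewrite mulr_ge0 ?divr_ge0 ?sqr_ge0// mulr_ge0 ?powR_ge0 ?dev_cst1_ge0.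
- by rewrite divr_ge0 ?sqr_ge0//.
Qed.

(** The increment is centred, so the first-order terms cancel, and P (1 - P)^2 + (1 - P) P^2 = P (1
    - P). *)
Lemma cos_bernoulli_step (x y P : R) : 0 <= P <= 1 ->
  `|P * cos (x - y * (1 - P)) + (1 - P) * cos (x + y * P)
    - (1 - y ^+ 2 / 2 * (P * (1 - P))) * cos x| <= 2 * `|y| ^+ 3.
Proof.
move=> /andP[P0 P1].
have h1 := cos_taylor x (- (y * (1 - P))).
have h2 := cos_taylor x (y * P).
have y3 : 0 <= `|y| ^+ 3 by rewrite exprn_ge0.
rewrite normrN normrM (@ger0_norm _ (1 - P)) ?subr_ge0// in h1.
rewrite normrM (ger0_norm P0) in h2.
have {}h1 : `|cos (x + - (y * (1 - P))) - (cos x - - (y * (1 - P)) * sin x -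
    (- (y * (1 - P))) ^+ 2 / 2 * cos x)| <= 2 * `|y| ^+ 3.
  rewrite (le_trans h1)// ler_wpM2l// exprMn ler_piMr// exprn_ile1//; lra.
have {}h2 : `|cos (x + y * P) - (cos x - y * P * sin x - (y * P) ^+ 2 / 2 * cos x)|
    <= 2 * `|y| ^+ 3.
  by rewrite (le_trans h2)// ler_wpM2l// exprMn ler_piMr// exprn_ile1.
set A := _ - _ in h1; set B := _ - _ in h2.
rewrite (_ : _ - _ = P * A + (1 - P) * B); last by rewrite /A /B; field.
rewrite (le_trans (ler_normD _ _))// !normrM (ger0_norm P0) (@ger0_norm _ (1 - P)) ?subr_ge0//.
by nra.
Qed.

Lemma chain_step_cos th ph n u : (0 < n)%N -> (n <= size u)%N ->
  let w := weight n (size u) in let x := th * mart_part n u + ph in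
  let lam := th ^+ 2 * limit_var / 2 in
  `|chain_step (fun t => cos (th * mart_part n t + ph)) u
    - expR (- (lam * w ^+ 2)) * cos x| <=
  w ^+ 2 * (2 * `|th| ^+ 3 * n%:R `^ (- (1 / 2)) + lam ^+ 2 / n%:R)
  + w ^+ 2 * (th ^+ 2 / 2) / (size u)%:R * `|deviation u|.
Proof.
move=> n0 nu; set w := weight _ _; set x := _ + ph; set lam := th ^+ 2 * _ / 2.
rewrite /=; set P := head_prob u.
have u0 : (0 < size u)%N by exact: leq_trans nu.
have u0' : 0 < (size u)%:R :> R by rewrite ltr0n.
have n0' : 0 < n%:R :> R by rewrite ltr0n.
have w0 : 0 <= w by exact: weight_ge0.
have wn := weight_le n0 nu; rewrite -/w in wn.
have h1 : `|chain_step (fun t => cos (th * mart_part n t + ph)) u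
    - (1 - (th * w) ^+ 2 / 2 * (P * (1 - P))) * cos x| <=
    w ^+ 2 * (2 * `|th| ^+ 3 * n%:R `^ (- (1 / 2))).
  have := cos_bernoulli_step x (th * w) (head_prob01 u).
  rewrite /chain_step !mart_part_cons// -/w -/P.
  rewrite (_ : th * (mart_part n u - w * (true%:R - P)) + ph = x - th * w * (1 - P)); last first.
    by rewrite /x /=; ring.
  rewrite (_ : th * (mart_part n u - w * (false%:R - P)) + ph = x + th * w * P); last first.
    by rewrite /x /=; ring.
  move=> /le_trans; apply; rewrite normrM (ger0_norm w0) exprMn (exprS w).
  rewrite (_ : 2 * _ = w ^+ 2 * (2 * `|th| ^+ 3 * w)); last by ring.
  by rewrite ler_wpM2l ?sqr_ge0// ler_wpM2l// mulr_ge0// exprn_ge0.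
have h2 : `|(1 - (th * w) ^+ 2 / 2 * (P * (1 - P))) * cos x -
    (1 - lam * w ^+ 2) * cos x| <= w ^+ 2 * (th ^+ 2 / 2) / (size u)%:R * `|deviation u|.
  rewrite -mulrBl normrM.
  apply: (@le_trans _ _ `|1 - (th * w) ^+ 2 / 2 * (P * (1 - P)) - (1 - lam * w ^+ 2)|).
    by rewrite ler_piMr// cos_max.
  (* The variances c (1 - c) and P (1 - P) differ by (c - P) (1 - c - P), with second factor at most
     1 in absolute value; c - P is - a D / m. *)
  rewrite (_ : _ - _ = w ^+ 2 * (th ^+ 2 / 2) * ((c - P) * (1 - c - P))); last first.
    by rewrite /lam /limit_var; move: c => k; field.
  have w2 : 0 <= w ^+ 2 * (th ^+ 2 / 2) by rewrite mulr_ge0 ?divr_ge0 ?sqr_ge0.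
  rewrite normrM (ger0_norm w2).
  rewrite -[leRHS]mulrA ler_wpM2l//.
  rewrite normrM (@le_trans _ _ `|c - P|)//.
    rewrite ler_piMr// ler_norml; have := head_prob01 u; rewrite -/P; have := fixpoint01.
    by move: c => k; lra.
  rewrite /P head_probE// opprD addNKr normrN !normrM normfV (gtr0_norm u0').
  rewrite [leRHS]mulrC ler_piMl// ?divr_ge0 ?(ltW u0')// ger0_norm; have := a12; lra.
have h3 : `|(1 - lam * w ^+ 2) * cos x - expR (- (lam * w ^+ 2)) * cos x| <=
    w ^+ 2 * (lam ^+ 2 / n%:R).
  have lam0 : 0 <= lam.
    by rewrite /lam divr_ge0// mulr_ge0 ?sqr_ge0//; have /andP[] := limit_var01.
  have lw0 : 0 <= lam * w ^+ 2 by rewrite mulr_ge0 ?sqr_ge0.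
  rewrite -mulrBl normrM distrC (le_trans (ler_piMr _ (cos_max x)))//.
  rewrite (le_trans (expRN_le_quad lw0))//.
  rewrite (_ : (lam * w ^+ 2) ^+ 2 = w ^+ 2 * (lam ^+ 2 * w ^+ 2)); last by ring.
  rewrite ler_wpM2l ?sqr_ge0// ler_wpM2l ?sqr_ge0//.
  have -> : n%:R^-1 = (n%:R `^ (- (1 / 2))) ^+ 2 :> R.
    by rewrite -powR_mulrn ?powR_ge0// -powRrM -powR_inv1 ?(ltW n0')//; congr (_ `^ _); field.
  by rewrite lerXn2r ?nnegrE ?powR_ge0.
apply: le_trans (ler_distD ((1 - (th * w) ^+ 2 / 2 * (P * (1 - P))) * cos x) _ _) _.
rewrite [w ^+ 2 * (_ + _)]mulrDr -[leRHS]addrA; apply: lerD h1 _.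
apply: le_trans (ler_distD ((1 - lam * w ^+ 2) * cos x) _ _) _.
by rewrite addrC; exact: lerD.
Qed.

Lemma chain_exp_cos th ph n N : (0 < n)%N -> (n <= N)%N ->
  `|chain_exp N (fun t => cos (th * mart_part n t + ph))
    - expR (- (th ^+ 2 * limit_var / 2 * weight_sum n N)) * cos ph| <=
  clt_error th n * weight_sum n N.
Proof.
move=> n0; set lam := th ^+ 2 * _ / _.
have n0' : 0 < n%:R :> R by rewrite ltr0n.
elim: N => [|N IH]; first by rewrite leqNgt n0.
rewrite leq_eqVlt => /predU1P[<-|]; last rewrite ltnS => nN.
  rewrite weight_sum0 !mulr0 oppr0 expR0 mul1r.
  rewrite (@chain_exp_eq _ _ (fun=> cos ph)) ?chain_exp_cst ?subrr ?normr0//.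
  by move=> t tn; rewrite mart_part0 ?tn// mulr0 add0r.
have N0 : (0 < N)%N by exact: leq_trans nN.
have N0' : 0 < N%:R :> R by rewrite ltr0n.
set w := weight n N.
set K := 2 * `|th| ^+ 3 * n%:R `^ (- (1 / 2)) + lam ^+ 2 / n%:R.
set E := expR (- (lam * w ^+ 2)).
have /andP[v0 v1] := limit_var01.
have E1 : E <= 1 by rewrite expR_le1 oppr_le0 mulr_ge0 ?sqr_ge0// /lam divr_ge0// mulr_ge0 ?sqr_ge0.
have h : `|chain_exp N.+1 (fun t => cos (th * mart_part n t + ph)) -
    E * chain_exp N (fun t => cos (th * mart_part n t + ph))| <=
    w ^+ 2 * clt_error th n.
  rewrite chain_expS -chain_expZ.
  apply: le_trans (@chain_exp_dist N _ _
    (fun u => w ^+ 2 * K + w ^+ 2 * (th ^+ 2 / 2) / N%:R * `|deviation u|) _) _.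
    move=> u uN; have := @chain_step_cos th ph n u n0.
    by rewrite uN => /(_ nN).
  rewrite chain_expD chain_exp_cst chain_expZ.
  have -> : clt_error th n = K + th ^+ 2 / 2 * (dev_cst1 * n%:R `^ (a - 1)).
    by rewrite /clt_error -/lam /K; ring.
  rewrite [leRHS]mulrDr lerD2l [leRHS]mulrA -[leLHS]mulrA ler_wpM2l//.
    by rewrite mulr_ge0 ?divr_ge0 ?sqr_ge0.
  rewrite ler_pdivrMl//.
  apply: le_trans (chain_exp_norm_deviation N0) _.
  rewrite mulrCA ler_wpM2l ?dev_cst1_ge0//.
  have a0 : 0 < a by have := a12; lra.
  (* N^a = N N^(a-1), and N^(a-1) <= n^(a-1) because a < 1. *)
  rewrite -(mulr_powRB1 (ltW N0') a0) ler_wpM2l ?(ltW N0')//.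
  rewrite -opprB !powRN lef_pV2 ?posrE ?powR_gt0//.
  by apply: ge0_ler_powR; rewrite ?nnegrE// ?ler_nat//; have := a12; lra.
rewrite weight_sumS// !mulrDr opprD expRD -/w -/E.
apply: le_trans (ler_distD (E * chain_exp N (fun t => cos (th * mart_part n t + ph))) _ _) _.
rewrite [leRHS]addrC; apply: lerD; first by rewrite [leRHS]mulrC.
rewrite [_ * E]mulrC -mulrA -mulrBr normrM ger0_norm ?expR_ge0//.
by rewrite (le_trans _ (IH nN))// ler_piMl.
Qed.

(** The fluctuation at time n seen from the horizon [size t], with L replaced by the value of Y
    there. *)
Definition gap n t : R := n%:R `^ (a - 1 / 2) *
  (normalized_dev (drop (size t - n) t) - normalized_dev t).

Definition drift_error n : R := 2 * dev_cst1 * (n%:R `^ (a - 1 / 2) / n%:R).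

Lemma drift_errorP n N : (0 < n)%N -> (n <= N)%N ->
  chain_exp N (fun t => `|drift_part n t|) <= drift_error n.
Proof.
move=> n0 nN; apply: le_trans (chain_exp_norm_drift n0 nN) _.
rewrite mulrBr (_ : _ * (2 / n%:R) = drift_error n); last first.
  by rewrite /drift_error; field; rewrite pnatr_eq0 -lt0n.
by rewrite gerBl mulr_ge0 ?divr_ge0// mulr_ge0 ?powR_ge0 ?dev_cst1_ge0.
Qed.

Lemma chain_exp_norm_gap n N : (0 < n)%N -> (n <= N)%N ->
  chain_exp N (fun t => `|gap n t|) <= (r^-1 + 1) / 2 + 2 * dev_cst1.
Proof.
move=> n0 nN.
apply: (@le_trans _ _ (chain_exp N (fun t => `|mart_part n t| + `|drift_part n t|))).
  by apply: chain_exp_le => t tN; rewrite /gap -mart_drift ?tN// ler_normD.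
rewrite chain_expD lerD ?chain_exp_norm_mart//.
rewrite (le_trans (drift_errorP n0 nN))// ler_piMr//.
  by rewrite mulr_ge0 ?dev_cst1_ge0.
rewrite ler_pdivrMr ?ltr0n// [leRHS]mul1r ler1_powR ?ler1n//.
by have := a12; lra.
Qed.

(** Three replacements: the gap by its martingale part, as the cosine is 1-Lipschitz; the expected
    cosine by its exponential; and r times the sum of squared weights by 1. *)
Lemma chain_exp_cos_gap th ph n N : (0 < n)%N -> (n <= N)%N ->
  `|chain_exp N (fun t => cos (th * gap n t + ph))
    - expR (- (th ^+ 2 / 2 * (limit_var / r))) * cos ph| <=
  `|th| * drift_error n + clt_error th n / r + th ^+ 2 / 2 * (limit_var / r) *
    (1 - n%:R `^ r * (n.+1%:R `^ (- r) - N.+1%:R `^ (- r))).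
Proof.
move=> n0 nN; have r0 : 0 < r by have := a12; lra.
have /andP[v0 _] := limit_var01.
set lam := th ^+ 2 / 2 * _.
have lam0 : 0 <= lam by rewrite mulr_ge0 ?divr_ge0 ?sqr_ge0 ?(ltW r0).
have ws1 : r * weight_sum n N <= 1 by exact: weight_sum_le.
rewrite -addrA.
apply: le_trans (ler_distD (chain_exp N (fun t => cos (th * mart_part n t + ph))) _ _) _.
apply: lerD.
  apply: le_trans (@chain_exp_dist N _ _ (fun t => `|th| * `|drift_part n t|) _) _.
    move=> t tN; rewrite /gap -mart_drift ?tN// mulrDr addrAC -normrM.
    exact: cos_lipschitz.
  by rewrite chain_expZ ler_wpM2l ?drift_errorP.
apply: le_trans (ler_distD (expR (- (lam * (r * weight_sum n N))) * cos ph) _ _) _.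
apply: lerD.
  have -> : lam * (r * weight_sum n N) = th ^+ 2 * limit_var / 2 * weight_sum n N.
    by rewrite /lam; field; lra.
  apply: le_trans (chain_exp_cos _ _ n0 nN) _.
  by rewrite ler_wpM2l ?clt_error_ge0// -[leRHS]mul1r ler_pdivlMr// mulrC.
rewrite -mulrBl normrM (le_trans (ler_piMr _ (cos_max ph)))//.
have l1 : lam * (r * weight_sum n N) <= lam by rewrite ler_piMr.
have l0 : 0 <= lam * (r * weight_sum n N).
  by rewrite mulr_ge0// mulr_ge0 ?weight_sum_ge0// (ltW r0).
apply: le_trans (expRN_lipschitz l0 l1) _.
by rewrite -{1}[lam]mulr1 -mulrBr ler_wpM2l// lerB// weight_sum_ge.
Qed.

End Chain.

(** * The law of the history *)

Section BoundedSum.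
Context d (T : measurableType d) (R : realType) (P : probability T R).

Lemma bounded_mfun_bigsum (I : Type) (r : seq I) (F : I -> T -> R) :
  (forall i, bounded_mfun (F i)) -> bounded_mfun (fun t => \sum_(i <- r) F i t).
Proof.
move=> Fb; elim: r => [|i r IH].
  by under eq_fun do rewrite big_nil; exact: bounded_mfun_cst.
by under eq_fun do rewrite big_cons; exact: bounded_mfunD.
Qed.

Lemma bounded_Rintegral_sum (I : Type) (r : seq I) (F : I -> T -> R) :
  (forall i, bounded_mfun (F i)) ->
  \int[P]_t (\sum_(i <- r) F i t) = \sum_(i <- r) \int[P]_t F i t.
Proof.
move=> Fb; elim: r => [|i r IH].
  under eq_Rintegral do rewrite big_nil.
  by rewrite big_nil Rintegral_probability_cst.
under eq_Rintegral do rewrite big_cons.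
by rewrite big_cons bounded_RintegralD// ?IH//; exact: bounded_mfun_bigsum.
Qed.

End BoundedSum.

Section History.
Context d (T : measurableType d) (R : realType) (P : probability T R).
Variables (p q s : R) (X alpha beta : nat -> {RV P >-> bool})
  (U : nat -> {RV P >-> nat}).
Hypothesis hs : 0 <= s <= 1.
Hypothesis hp : 0 <= p <= 1.
Hypothesis hq : 0 <= q <= 1.
Hypothesis hX : minimal_random_walk p q s X alpha beta U.

Fixpoint history n w : seq bool :=
  if n is m.+1 then X m.+1 w :: history m w else [::].

Lemma size_history n w : size (history n w) = n.
Proof. by elim: n => //= n ->. Qed.

Lemma history_rev n w :
  history n w = rev [tuple X i.+1 w | i < n].
Proof.
rewrite /= (_ : map _ (enum 'I_n) = [seq X i.+1 w | i <- iota 0 n]).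
  elim: n => [//|n IH].
  by rewrite -{2}(addn1 n) iotaD map_cat rev_cat /= -IH.
by rewrite -val_enum_ord -map_comp.
Qed.

Lemma nth_history n w k : (k < n)%N -> nth false (history n w) k = X (n - k)%N w.
Proof.
elim: n k => [//|n IH] [|k] kn /=; first by rewrite subn0.
by rewrite IH// subSS.
Qed.

Let ev n (t : seq bool) : set T := [set w | history n w = t].
Let pr (A : set T) : R := fine (P A).

Let measurable_X n b : measurable (X n @^-1` [set b]).
Proof. by rewrite -[X in measurable X]setTI; apply: measurable_funP. Qed.

Let measurable_U n (C : set nat) : measurable (U n @^-1` C).
Proof. by rewrite -[X in measurable X]setTI; apply: measurable_funP. Qed.

Let measurable_ev n t : measurable (ev n t).
Proof.
elim: n t => [|n IH] [|b t].
- by rewrite (_ : ev _ _ = setT)//; apply/seteqP.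
- by rewrite (_ : ev _ _ = set0)//; apply/seteqP; split => // w.
- by rewrite (_ : ev _ _ = set0)//; apply/seteqP; split => // w.
- rewrite (_ : ev _ _ = X n.+1 @^-1` [set b] `&` ev n t); first exact: measurableI.
  by apply/seteqP; split => w; rewrite /ev/=; [case|move=> [-> ->]].
Qed.

Let prD A B : measurable A -> measurable B -> [disjoint A & B] -> pr (A `|` B) = pr A + pr B.
Proof.
move=> mA mB /disj_setPS AB; rewrite /pr measureU//; last by apply/seteqP; split.
by rewrite fineD// fin_num_measure.
Qed.

Let pr_le A B : measurable A -> measurable B -> A `<=` B -> pr A <= pr B.
Proof.
by move=> mA mB AB; rewrite /pr fine_le ?fin_num_measure// le_measure ?inE.
Qed.

Let sum_U_le n m A : measurable A ->
  \sum_(k < m) pr (A `&` U n @^-1` [set k.+1]) <= pr A.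
Proof.
move=> mA.
have -> : \sum_(k < m) pr (A `&` U n @^-1` [set k.+1]) =
    pr (A `&` U n @^-1` [set j | (0 < j <= m)%N]).
  elim: m => [|m IH].
    rewrite big_ord0 (_ : _ `&` _ = set0) /pr ?measure0//.
    by apply/seteqP; split => // w [_] /=; case: (U n w).
  rewrite big_ord_recr /= IH -prD; last 3 first.
  - by apply: measurableI => //; exact: measurable_U.
  - by apply: measurableI => //; exact: measurable_U.
  - apply/disj_setPS => w [[_ /= /andP[_ h1]] [_ /= h2]].
    by rewrite h2 ltnn in h1.
  congr pr; apply/seteqP; split => w /=.
    case=> [[Aw /andP[-> h]]|[Aw ->]]; split => //; first exact: leqW.
    by rewrite ltnSn.
  move=> [Aw /andP[h0]]; rewrite leq_eqVlt => /predU1P[h|h]; [right|left]; split => //.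
  by rewrite h0.
apply: pr_le => //; first by apply: measurableI => //; exact: measurable_U.
Qed.

Let pr_bernoulli (Y : {RV P >-> bool}) (r : R) b : 0 <= r <= 1 ->
  distribution P Y =1 bernoulli_prob r -> pr (Y @^-1` [set b]) = if b then r else 1 - r.
Proof.
move=> r01 hY; transitivity (fine (distribution P Y [set b])); first by [].
rewrite hY.
by rewrite /bernoulli_prob r01 fsbig_set1; case: b.
Qed.

(** The value of X_(k+1) read off a history of length n, which is stored in reverse order. *)
Let bit n (t : seq bool) k := nth false t (n - k.+1)%N.

Let XE n w : (0 < n)%N -> X n.+1 w = if X (U n w) w then alpha n.+1 w else beta n.+1 w.
Proof.
move=> n0; have := mrw_rec hX n0 w.
case: (X n.+1 w); case: (X (U n w) w); case: (alpha n.+1 w); case: (beta n.+1 w) => //=;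
  by rewrite ?(subrr, subr0, mulr0, mul0r, mulr1, mul1r, addr0, add0r) => /eqP;
     rewrite ?oner_eq0 ?(eq_sym 0) ?oner_eq0.
Qed.

Let prI4 n A B C t : (0 < n)%N ->
  pr (alpha n.+1 @^-1` A `&` beta n.+1 @^-1` B `&` U n @^-1` C `&` ev n t) =
  pr (alpha n.+1 @^-1` A) * pr (beta n.+1 @^-1` B) * pr (U n @^-1` C) * pr (ev n t).
Proof.
(* [step_independent] speaks of tuples in chronological order, hence the reversal in the event. *)
move=> n0; have := mrw_indep hX n0 A B C [set u | rev u = t].
rewrite /= (_ : [set w | _] = ev n t); last first.
  by apply/seteqP; split => w; rewrite /ev /= history_rev.
move=> h; rewrite /pr h !fineM// ?fin_numM// fin_num_measure ?measurable_ev//;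
  by rewrite -[X in measurable X]setTI; apply: measurable_funP.
Qed.

Let pr_U n k : (k < n)%N -> pr (U n @^-1` [set k.+1]) = n%:R^-1.
Proof.
move=> kn; transitivity (fine (distribution P (U n) [set k.+1])); first by [].
by rewrite (mrw_U hX (n := n)) ?(leq_trans _ kn).
Qed.

Let pr_setT (Y : {RV P >-> bool}) : pr (Y @^-1` setT) = 1.
Proof. by rewrite preimage_setT /pr probability_setT. Qed.

(** Once the history and U_n are fixed, X_(n+1) is [alpha] or [beta] according to the bit drawn, and
    the event becomes an intersection of independent ones. *)
Let pr_step_U n t k b : (k < n)%N ->
  pr (X n.+1 @^-1` [set b] `&` ev n t `&` U n @^-1` [set k.+1]) =
  (if b then if bit n t k then p else q else 1 - if bit n t k then p else q)
    / n%:R * pr (ev n t).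
Proof.
move=> kn; have n0 : (0 < n)%N by exact: leq_ltn_trans kn.
have Xbit w : ev n t w -> X k.+1 w = bit n t k.
  by move=> <-; rewrite /bit nth_history ?subKn// ltn_subrL n0.
have [bt|bt] := boolP (bit n t k).
  rewrite (_ : _ `&` _ = alpha n.+1 @^-1` [set b] `&` beta n.+1 @^-1` setT
      `&` U n @^-1` [set k.+1] `&` ev n t); last first.
    apply/seteqP; split => w /=.
      move=> [[h1 h2] h3]; move: h1; rewrite XE// h3 Xbit// bt => h1.
      by [].
    by move=> [[[h1 _] h3] h2]; rewrite XE// h3 Xbit// bt.
  by rewrite prI4// pr_setT mulr1 pr_U// (pr_bernoulli _ hp (mrw_alpha hX n0)).
rewrite (_ : _ `&` _ = alpha n.+1 @^-1` setT `&` beta n.+1 @^-1` [set b]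
      `&` U n @^-1` [set k.+1] `&` ev n t); last first.
  apply/seteqP; split => w /=.
    move=> [[h1 h2] h3]; move: h1; rewrite XE// h3 Xbit// (negbTE bt) => h1.
    by [].
  by move=> [[[_ h1] h3] h2]; rewrite XE// h3 Xbit// (negbTE bt).
by rewrite prI4// pr_setT mul1r pr_U// (pr_bernoulli _ hq (mrw_beta hX n0)).
Qed.

Let sum_bit n t : size t = n -> \sum_(k < n) (bit n t k)%:R = (count id t)%:R :> R.
Proof.
move=> <-; rewrite /bit (reindex_inj rev_ord_inj)/=.
under eq_bigr => i _ do rewrite subnSK// subKn ?(ltnW (ltn_ord i))//.
elim: t => [|b t IH]; first by rewrite big_ord0.
by rewrite big_ord_recl /= natrD IH.
Qed.

Local Notation hprob := (head_prob (p - q) q s).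

(* Conditioning on U n = k for k = 1, ..., n bounds both probabilities from
   below, and the two bounds already add up to the probability of the history. *)
Lemma pr_history_step n t b : size t = n ->
  pr (X n.+1 @^-1` [set b] `&` ev n t) =
  (if b then hprob t else 1 - hprob t) * pr (ev n t).
Proof.
move=> tn; have [n0|n0] := posnP n.
  move: tn; rewrite n0 => /size0nil ->.
  rewrite (_ : ev 0 [::] = setT); last by apply/seteqP.
  by rewrite setIT [pr setT]/pr probability_setT mulr1 (pr_bernoulli _ hs (mrw_X1 hX)).
have n0' : 0 < n%:R :> R by rewrite ltr0n.
have hE : hprob t = \sum_(k < n) (if bit n t k then p else q) / n%:R.
  rewrite (eq_bigr (fun k : 'I_n => (q + (p - q) * (bit n t k)%:R) / n%:R)); last first.
    by move=> k _; case: (bit n t k); rewrite ?mulr1 ?mulr0 ?addr0 ?subrKC.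
  rewrite -mulr_suml big_split /= -mulr_sumr sum_bit// sumr_const card_ord.
  rewrite /head_prob -[in RHS]tn; move: tn; case: (t) => [/= tn|b' t' _].
    by rewrite -tn in n0.
  by rewrite -mulr_natr; field; rewrite pnatr_eq0.
have le_b b' : (if b' then hprob t else 1 - hprob t) * pr (ev n t) <=
    pr (X n.+1 @^-1` [set b'] `&` ev n t).
  apply: le_trans (sum_U_le n n _); last by apply: measurableI.
  rewrite le_eqVlt; apply/orP; left; apply/eqP.
  under [RHS]eq_bigr => k _ do rewrite pr_step_U//.
  rewrite -mulr_suml; congr (_ * _); case: b'; first exact: hE.
  rewrite hE; under [RHS]eq_bigr => k _ do rewrite mulrBl mul1r.
  by rewrite sumrB sumr_const card_ord -(mulr_natr (n%:R^-1) n) mulVf ?gt_eqF.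
have sumE : pr (X n.+1 @^-1` [set true] `&` ev n t) +
    pr (X n.+1 @^-1` [set false] `&` ev n t) = pr (ev n t).
  rewrite -prD; last 3 first.
  - exact: measurableI.
  - exact: measurableI.
  - by apply/disj_setPS => w [[/= -> _] []].
  congr pr; apply/seteqP; split => w /=; first by case=> -[].
  by move=> h; case: (X n.+1 w); [left|right].
have := le_b true; have := le_b false; case: b; lra.
Qed.

Let chainE := chain_exp (p - q) q s.

Lemma bounded_mfun_history n (g : seq bool -> R) :
  bounded_mfun (fun w => g (history n w)).
Proof.
have -> : (fun w => g (history n w)) =
    (fun w => \sum_(t : n.-tuple bool) g t * \1_(ev n t) w).
  apply/funext => w; pose tw := @Tuple n bool (history n w) (introT eqP (size_history n w)).
  rewrite (bigD1 tw)//= big1 ?addr0 => [|t tw'].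
    by rewrite indicE mem_set ?mulr1.
  rewrite indicE memNset ?mulr0// => e.
  by move/eqP: tw'; apply; apply: val_inj.
by apply: bounded_mfun_bigsum => t; apply: bounded_mfunZ; exact: bounded_mfun_indic.
Qed.

(** A function of the history is a finite combination of indicators of histories; splitting each by
    its next bit and applying [pr_history_step] reproduces [chain_step]. *)
Lemma Rintegral_history n (g : seq bool -> R) :
  \int[P]_w g (history n w) = chainE n g.
Proof.
elim: n g => [|n IH] g; first by rewrite /= Rintegral_probability_cst.
rewrite [RHS]/= -/(chainE n _) -IH.
have mXe b (t : seq bool) : measurable (X n.+1 @^-1` [set b] `&` ev n t).
  exact: measurableI.
transitivity (\int[P]_w \sum_(t : n.-tuple bool)
    (g (true :: t) * \1_(X n.+1 @^-1` [set true] `&` ev n t) w +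
     g (false :: t) * \1_(X n.+1 @^-1` [set false] `&` ev n t) w)).
  apply: eq_Rintegral => w _ /=.
  pose tw := @Tuple n bool (history n w) (introT eqP (size_history n w)).
  rewrite (bigD1 tw)//= big1 ?addr0 => [|t tw'].
    rewrite !indicE; case Xw : (X n.+1 w).
      have h1 : (X n.+1 @^-1` [set true] `&` ev n (history n w)) w by split.
      have h2 : ~ (X n.+1 @^-1` [set false] `&` ev n (history n w)) w by case => /=; rewrite Xw.
      by rewrite (mem_set h1) (memNset h2) mulr1 mulr0 addr0.
    have h1 : (X n.+1 @^-1` [set false] `&` ev n (history n w)) w by split.
    have h2 : ~ (X n.+1 @^-1` [set true] `&` ev n (history n w)) w by case => /=; rewrite Xw.
    by rewrite (mem_set h1) (memNset h2) mulr1 mulr0 add0r.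
  have tw'' : ~ ev n t w by move=> e; move/eqP: tw'; apply; apply: val_inj.
  by rewrite !indicE !memNset ?mulr0 ?addr0// => -[].
transitivity (\int[P]_w \sum_(t : n.-tuple bool)
    chain_step (p - q) q s g t * \1_(ev n t) w); last first.
  apply: eq_Rintegral => w _ /=.
  pose tw := @Tuple n bool (history n w) (introT eqP (size_history n w)).
  rewrite (bigD1 tw)//= big1 ?addr0 => [|t tw'].
    by rewrite indicE mem_set ?mulr1.
  rewrite indicE memNset ?mulr0// => e.
  by move/eqP: tw'; apply; apply: val_inj.
have Zb (x : R) A : measurable A -> bounded_mfun (fun w => x * \1_A w).
  by move=> mA; apply: bounded_mfunZ; exact: bounded_mfun_indic.
rewrite !bounded_Rintegral_sum//; last 2 first.
- by move=> t; exact: Zb.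
- by move=> t; apply: bounded_mfunD; exact: Zb.
apply: eq_bigr => t _.
have IZ (x : R) A : measurable A -> \int[P]_w (x * \1_A w) = x * pr A.
  move=> mA; rewrite bounded_RintegralZ; last exact: bounded_mfun_indic.
  by rewrite Rintegral_probability_indic.
rewrite bounded_RintegralD; [|exact: Zb|exact: Zb].
rewrite !IZ// !pr_history_step ?size_tuple//.
by rewrite /chain_step; ring.
Qed.

End History.

(** * Convergence of the fluctuations *)

Section Limits.
Context {R : realType}.

Lemma cvg_powRN_nat (e : R) : 0 < e -> n%:R `^ (- e) @[n --> \oo] --> (0 : R).
Proof.
move=> e0; apply/cvgrPdist_le => eps eps0.
(* The solution of M^(-e) = eps. *)
pose M := eps `^ (- e^-1).
have M0 : 0 < M by exact: powR_gt0.
near=> n; rewrite sub0r normrN ger0_norm ?powR_ge0//.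
have nM : M <= n%:R by near: n; exact: nbhs_infty_ger.
have n0 : 0 < n%:R :> R by exact: lt_le_trans nM.
have -> : eps = M `^ (- e) by rewrite /M -powRrM mulrNN mulVf ?gt_eqF// powRr1// ltW.
rewrite !powRN lef_pV2 ?posrE ?powR_gt0//.
by apply: ge0_ler_powR; rewrite ?nnegrE ?(ltW e0) ?(ltW M0) ?(ltW n0).
Unshelve. all: end_near. Qed.

Lemma bounded_convergence d (T : measurableType d) (P : probability T R)
    (f_ : nat -> T -> R) (f : T -> R) (M : R) :
  (forall n, measurable_fun setT (f_ n)) -> measurable_fun setT f ->
  (forall n w, `|f_ n w| <= M) ->
  {ae P, forall w, f_ n w @[n --> \oo] --> f w} ->
  \int[P]_w f_ n w @[n --> \oo] --> \int[P]_w f w.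
Proof.
move=> mf_ mf fM ff.
have [] := @dominated_convergence _ _ _ P setT measurableT
  (fun n => EFin \o f_ n) (EFin \o f) (EFin \o cst M).
- by move=> n; exact/measurable_EFinP.
- exact/measurable_EFinP.
- by apply: filterS ff => w fw _; apply: cvg_EFin => //; exact: nearW.
- exact: finite_measure_integrable_cst.
- by apply: aeW => w n _; rewrite /= lee_fin.
move=> fi _ H; rewrite /Rintegral; apply: fine_cvg.
by rewrite fineK//; exact: integrable_fin_num.
Qed.

End Limits.

(** * From a finite horizon to the limit L, then n to infinity *)

Section Assembly.
Context d (T : measurableType d) (R : realType) (P : probability T R).
Variables (p q s : R) (X alpha beta : nat -> {RV P >-> bool})
  (U : nat -> {RV P >-> nat}) (L : {RV P >-> R}).
Hypothesis hp : 0 <= p <= 1.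
Hypothesis hq : 0 <= q <= 1.
Hypothesis hs : 0 <= s <= 1.
Hypothesis hX : minimal_random_walk p q s X alpha beta U.
Local Notation a := (p - q).
Hypothesis a12 : 1 / 2 < a < 1.
Hypothesis hL : {ae P, forall w, rescaled_position X p q n w @[n --> \oo] --> L w}.

Let p01 : 0 <= q + (p - q) <= 1. Proof. by rewrite subrKC. Qed.

Local Notation r := (2 * a - 1).
Let r0 : 0 < r. Proof. by have := a12; lra. Qed.

Definition fluctuation n w := (rescaled_position X p q n w - L w) * n%:R `^ (a - 1 / 2).

Lemma drop_history N n w : (n <= N)%N ->
  drop (N - n) (history X N w) = history X n w.
Proof.
elim: N => [|N IH]; first by rewrite leqn0 => /eqP ->.
rewrite leq_eqVlt => /predU1P[->|]; first by rewrite subnn drop0.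
by rewrite ltnS => nN; rewrite subSn//= IH.
Qed.

Lemma rescaled_positionE n w : (0 < n)%N ->
  rescaled_position X p q n w = normalized_dev a q (history X n w).
Proof.
move=> n0; have n0' : 0 < n%:R :> R by rewrite ltr0n.
rewrite /rescaled_position /normalized_dev /deviation size_history.
have -> : position X n w = (count id (history X n w))%:R :> R.
  rewrite /position; elim: n {n0 n0'} => [|n IH]; first by rewrite big_geq.
  by rewrite big_nat_recr//= IH natrD addrC.
rewrite (@powRB _ n%:R 1 a) ?(gt_eqF n0') ?implybT// powRr1 ?(ltW n0')//.
have := powR_gt0 a n0'; move: (_ `^ _) => x x0.
have := a12 => a1; field.
by rewrite !gt_eqF//; lra.
Qed.

Lemma gap_history n N w : (0 < n)%N -> (n <= N)%N -> gap a q n (history X N w) =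
  n%:R `^ (a - 1 / 2) * (rescaled_position X p q n w - rescaled_position X p q N w).
Proof.
move=> n0 nN; rewrite /gap size_history drop_history// !rescaled_positionE//.
exact: leq_trans nN.
Qed.

Lemma gap_cvg n : (0 < n)%N ->
  {ae P, forall w, gap a q n (history X N w) @[N --> \oo] --> fluctuation n w}.
Proof.
move=> n0; apply: filterS hL => w Lw.
rewrite /fluctuation mulrC.
have H : n%:R `^ (a - 1 / 2) * (rescaled_position X p q n w - rescaled_position X p q N w)
    @[N --> \oo] --> n%:R `^ (a - 1 / 2) * (rescaled_position X p q n w - L w).
  by apply: cvgM; [exact: cvg_cst|apply: cvgB => //; exact: cvg_cst].
apply: cvg_trans H; apply: near_eq_cvg; near=> N.
rewrite gap_history//; near: N; exact: nbhs_infty_ge.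
Unshelve. all: end_near. Qed.

Lemma measurable_fluctuation n : measurable_fun setT (fluctuation n).
Proof.
apply: measurable_funM => //; apply: measurable_funB => //.
Qed.

(** For fixed n the gap tends almost surely to the fluctuation as the horizon grows, and h is
    bounded and continuous. Estimates on the chain uniform in N thereby reach L. *)
Lemma Rintegral_fluctuation_cvg n (h : R -> R) M : (0 < n)%N -> continuous h ->
  (forall x, `|h x| <= M) ->
  chain_exp a q s N (fun t => h (gap a q n t)) @[N --> \oo]
    --> \int[P]_w h (fluctuation n w).
Proof.
move=> n0 ch hM.
under eq_fun => N do rewrite -(Rintegral_history hs hp hq hX N (fun t => h (gap a q n t))).
have mh : measurable_fun setT h by exact: continuous_measurable_fun.
apply: (@bounded_convergence _ _ _ _ _ _ M).
- by move=> N; have [] := bounded_mfun_history X N (fun t => h (gap a q n t)).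
- exact: measurableT_comp mh (measurable_fluctuation n).
- by move=> N w; exact: hM.
- by apply: filterS (gap_cvg n0) => w; apply: continuous_cvg; exact: ch.
Qed.

Local Notation V := (limit_var a q / r).

Lemma fluctuation_cos_dist th ph n : (0 < n)%N ->
  `|\int[P]_w cos (th * fluctuation n w + ph) - expR (- (th ^+ 2 / 2 * V)) * cos ph| <=
  `|th| * drift_error a n + clt_error a q th n / r + th ^+ 2 / 2 * V *
    (1 - n%:R `^ r * n.+1%:R `^ (- r)).
Proof.
move=> n0.
have c1 : continuous (fun x : R => cos (th * x + ph)).
  move=> x; apply: differentiable_continuous; apply/derivable1_diffP.
  have h0 : is_derive x 1 (fun x => th * x + ph) th.
    by apply: is_derive_eq; rewrite /GRing.scale/= mulr1 addr0.
  by [].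
have H := @Rintegral_fluctuation_cvg n _ 1 n0 c1 (fun x => cos_max _).
have H1 : `|chain_exp a q s N (fun t => cos (th * gap a q n t + ph)) -
    expR (- (th ^+ 2 / 2 * V)) * cos ph| @[N --> \oo] -->
    `|\int[P]_w cos (th * fluctuation n w + ph) - expR (- (th ^+ 2 / 2 * V)) * cos ph|.
  by apply: cvg_norm; apply: cvgB => //; exact: cvg_cst.
have H2 : `|th| * drift_error a n + clt_error a q th n / r + th ^+ 2 / 2 * V *
    (1 - n%:R `^ r * (n.+1%:R `^ (- r) - N.+1%:R `^ (- r))) @[N --> \oo] -->
    `|th| * drift_error a n + clt_error a q th n / r + th ^+ 2 / 2 * V *
    (1 - n%:R `^ r * (n.+1%:R `^ (- r) - 0)).
  apply: cvgD; first exact: cvg_cst.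
  apply: cvgM; first exact: cvg_cst.
  apply: cvgB; first exact: cvg_cst.
  apply: cvgM; first exact: cvg_cst.
  apply: cvgB; first exact: cvg_cst.
  have := cvg_powRN_nat r0; rewrite -(cvg_shiftS (fun n => n%:R `^ (- r))).
  by [].
rewrite subr0 in H2.
apply: (ler_cvg_to H1 H2); near=> N.
apply: chain_exp_cos_gap => //.
by near: N; exact: nbhs_infty_ge.
Unshelve. all: end_near. Qed.

Lemma fluctuation_error_cvg0 th :
  `|th| * drift_error a n + clt_error a q th n / r + th ^+ 2 / 2 * V *
    (r / n%:R) @[n --> \oo] --> (0 : R).
Proof.
(* The errors decay like n^(a - 3/2) for the drift and n^(-1/2), n^(a - 1), 1 / n for the rest, all
   exponents being negative as a < 1. *)
have a1 := a12; have h : 0 < 1 - a by lra.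
have h2 : 0 < 1 / 2 :> R by rewrite divr_gt0.
have h3 : 0 < 3 / 2 - a by lra.
have inv0 : n%:R^-1 @[n --> \oo] --> (0 : R).
  have := @cvg_powRN_nat R 1 ltr01.
  by under eq_fun do rewrite powR_inv1//.
have Mc (k : R) (f : nat -> R) : f n @[n --> \oo] --> (0 : R) -> k * f n @[n --> \oo] --> (0 : R).
  by move=> f0; rewrite -(mulr0 k); apply: cvgM => //; exact: cvg_cst.
have D0 (f g : nat -> R) : f n @[n --> \oo] --> (0 : R) -> g n @[n --> \oo] --> (0 : R) ->
    f n + g n @[n --> \oo] --> (0 : R).
  by move=> f0 g0; rewrite -(addr0 0); exact: cvgD.
have T1 : `|th| * drift_error a n @[n --> \oo] --> (0 : R).
  apply/Mc/Mc; have := cvg_powRN_nat h3; apply: cvg_trans; apply: near_eq_cvg; near=> n.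
  have n0 : (0 < n)%N by near: n; exact: nbhs_infty_gt.
  rewrite (_ : - (3 / 2 - a) = (a - 1 / 2) + (- 1)); last by field.
  by rewrite powR_natD// powR_inv1.
have T2 : r^-1 * clt_error a q th n @[n --> \oo] --> (0 : R).
  apply/Mc; rewrite /clt_error.
  have U1 := Mc (2 * `|th| ^+ 3) _ (cvg_powRN_nat h2).
  have U2 := Mc (th ^+ 2 / 2) _ (Mc (dev_cst1 a) _ (cvg_powRN_nat h)).
  have U3 := Mc ((th ^+ 2 * limit_var a q / 2) ^+ 2) _ inv0.
  rewrite opprB in U2.
  exact: (D0 _ _ (D0 _ _ U1 U2) U3).
have T3 := Mc (th ^+ 2 / 2 * V) _ (Mc r _ inv0).
under eq_fun => n do rewrite [clt_error _ _ _ _ / _]mulrC.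
exact: (D0 _ _ (D0 _ _ T1 T2) T3).
Unshelve. all: end_near. Qed.

Lemma fluctuation_cos_cvg th ph :
  \int[P]_w cos (th * fluctuation n w + ph) @[n --> \oo] -->
  expR (- (th ^+ 2 / 2 * V)) * cos ph.
Proof.
apply/subr_cvg0; apply: norm_cvg0.
apply: (squeeze_cvgr _ (cvg_cst 0) (fluctuation_error_cvg0 th)).
near=> n; rewrite normr_ge0/=.
have n0 : (0 < n)%N by near: n; exact: nbhs_infty_gt.
apply: le_trans (fluctuation_cos_dist th ph n0) _.
rewrite lerD2l ler_wpM2l//.
  rewrite mulr_ge0 ?divr_ge0 ?sqr_ge0 ?(ltW r0)//.
  by have /andP[] := limit_var01 hq p01 a12.
(* This is 1 - (n / (n+1))^r <= r / n. *)
have := powRN_step_le n0 (ltW r0) => /(ler_wpM2l (powR_ge0 n%:R r)).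
rewrite mulrBr -powR_natD// subrr powRr0 => /le_trans; apply.
rewrite mulrCA -powR_natD// (_ : r + - (r + 1) = -1); last by ring.
by rewrite powR_inv1.
Unshelve. all: end_near. Qed.

(** Markov's inequality with |x| / K truncated at 1: the truncation is bounded and continuous, so
    the first-moment bound on the gap survives the passage to L. *)
Lemma fluctuation_tight : exists C : R, forall n K, (0 < n)%N -> 0 < K ->
  fine (P [set w | K <= `|fluctuation n w|]) <= C / K.
Proof.
exists ((r^-1 + 1) / 2 + 2 * dev_cst1 a) => n K n0 K0.
pose h (x : R) := Num.min 1 (`|x| / K).
have ch : continuous h.
  move=> x; apply: (@continuous_min _ _ (fun=> 1) (fun x : R => `|x| / K)).
    exact: cvg_cst.
  by apply: cvgM; [exact: norm_continuous|exact: cvg_cst].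
have h0 x : 0 <= h x by rewrite le_min ler01 divr_ge0// ltW.
have h1 x : h x <= 1 by rewrite ge_min lexx.
have hM x : `|h x| <= 1 by rewrite ger0_norm.
have mh : measurable_fun setT h by exact: continuous_measurable_fun.
have mA : measurable [set w | K <= `|fluctuation n w|].
  rewrite (_ : [set w | _] = (fun w => `|fluctuation n w|) @^-1` `[K, +oo[%classic); last first.
    by apply/seteqP; split => u /=; rewrite in_itv/= andbT.
  rewrite -[X in measurable X]setTI.
  have : measurable_fun setT (fun w => `|fluctuation n w|).
    exact: measurableT_comp (measurable_fluctuation n).
  by apply.
apply: (@le_trans _ _ (\int[P]_w h (fluctuation n w))).
  rewrite -Rintegral_probability_indic//; apply: le_bounded_Rintegral.
  - exact: bounded_mfun_indic.
  - split; first exact: measurableT_comp mh (measurable_fluctuation n).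
    by exists 1 => w; exact: hM.
  - move=> w; rewrite indicE; have [|_] := boolP (w \in _); last exact: h0.
    rewrite inE /= => Kw; rewrite le_min lexx/= ler_pdivlMr//.
    by rewrite mul1r.
have H := @Rintegral_fluctuation_cvg n h 1 n0 ch hM.
apply: (@ler_cvg_to _ _ _ _ _ _ _ _ H (cvg_cst _)).
near=> N.
have nN : (n <= N)%N by near: N; exact: nbhs_infty_ge.
rewrite mulrC; apply: le_trans (ler_wpM2l _ (chain_exp_norm_gap hq p01 hs a12 n0 nN)).
  rewrite -chain_expZ//; apply: chain_exp_le => // t _.
  by rewrite mulrC /h ge_min lexx orbT.
by rewrite invr_ge0 ltW.
Unshelve. all: end_near. Qed.

End Assembly.

Lemma Rintegral_distribution d (T : measurableType d) (R : realType)
    (P : probability T R) (Z : {mfun T >-> measurableTypeR R})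
    (h : measurableTypeR R -> R) :
  bounded_mfun h -> \int[distribution P Z]_x h x = \int[P]_w h (Z w).
Proof.
move=> [mh [M hM]]; rewrite /Rintegral integral_distribution//.
  exact/measurable_EFinP.
apply: bounded_mfun_integrable; split; last by exists M => w; exact: hM.
exact: (measurableT_comp mh (measurable_funP Z)).
Qed.

Theorem theorem2p7 (d : measure_display) (T : measurableType d) (R : realType)
    (P : probability T R) (p q s : R)
    (X alpha beta : nat -> {RV P >-> bool}) (U : nat -> {RV P >-> nat})
    (L : {RV P >-> R})
    (hp : 0 <= p <= 1) (hq : 0 <= q <= 1) (hs : 0 <= s <= 1)
    (hpq : (p, q) <> (1, 0))
    (hX : minimal_random_walk p q s X alpha beta U) :
  let a := p - q in
  let sigma2 := q * (1 - p) / (1 - a) ^+ 2 in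
  1 / 2 < a ->
  {ae P, forall w, rescaled_position X p q n w @[n --> \oo] --> L w} ->
  cvg_in_distribution
    (fun n => Num.sqrt (n%:R `^ (2 * a - 1))
                \o* (rescaled_position X p q n \- L) : {RV P >-> R})
    (normal_law 0 (sigma2 / (2 * a - 1))).
Proof.
move=> a sigma2 a_gt hL.
(* Here a = 1 would force p = 1 and q = 0, the excluded pair. *)
have a12 : 1 / 2 < p - q < 1.
  rewrite a_gt/= lt_neqAle; apply/andP; split; last by move: hp hq; lra.
  apply/eqP => a1; apply: hpq.
  by have -> : p = 1; [move: hp hq; lra|]; have -> : q = 0; [move: hp hq; lra|].
have a1 : 1 - a != 0 by rewrite /a; lra.
have p01 : 0 <= q + (p - q) <= 1 by rewrite subrKC.
have VE : sigma2 = limit_var (p - q) q.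
  by rewrite /sigma2 /limit_var -/a /a; field.
have V0 : 0 <= sigma2 / (2 * a - 1).
  rewrite VE divr_ge0//; last by rewrite /a; lra.
  by have /andP[] := limit_var01 hq p01 a12.
set Z := fun n => _ : {RV P >-> R}.
have ZE n w : Z n w = fluctuation p q X L n w.
  rewrite /Z /= /fluctuation; congr (_ * _).
  rewrite -powR12_sqrt ?powR_ge0// -powRrM; congr (_ `^ _).
  by rewrite /a; field.
have mZ n : measurable_fun setT (Z n : T -> measurableTypeR R).
  exact: (measurable_funP (Z n)).
(* The same functions with codomain [measurableTypeR R], the space on which [normal_law] and
   [levy_cdf] are stated. *)
pose Z' n : {mfun T >-> measurableTypeR R} :=
  HB.pack_for {mfun T >-> measurableTypeR R} (Z n : T -> measurableTypeR R)
    (isMeasurableFun.Build _ _ _ _ (Z n : T -> measurableTypeR R) (mZ n)).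
move=> x Fx.
apply: (@levy_cdf R (fun n => distribution P (Z' n) : probability (measurableTypeR R) R)
  (normal_law 0 (sigma2 / (2 * a - 1))) _ _ x Fx).
- move=> th ph; rewrite normal_law_cos// VE.
  rewrite (_ : (fun n => _) =
      (fun n => \int[P]_w cos (th * fluctuation p q X L n w + ph))); last first.
    apply/funext => n; rewrite Rintegral_distribution; last exact: bounded_mfun_cos.
    by apply: eq_Rintegral => w _; rewrite -ZE.
  exact: (fluctuation_cos_cvg hp hq hs hX a12 hL).
- have [C HC] := fluctuation_tight hp hq hs hX a12 hL.
  exists C => n K n0 K0; apply: le_trans (HC n K n0 K0).
  rewrite le_eqVlt; apply/orP; left; apply/eqP.
  by congr (fine (P _)); apply/seteqP; split => w /=; rewrite -ZE.
Qed.
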